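(* Let $m\geq 2$ and let $T$ be a tree with $m$ vertices, and let $n\geq m$ be an integer. Then the Stirling complex $\mathcal{S}tr(T,n)$ is homotopy equivalent to a wedge of $(n-m)$-dimensional spheres, and the number of spheres in this wedge is \[ f(m,n)=(m-1)^n-\binom{m}{1}(m-2)^n+\binom{m}{2}(m-3)^n-\dots+(-1)^{m-1}\binom{m}{m-3}2^n+(-1)^m\binom{m}{m-2}, \] that is, $f(m,n)=\sum_{\alpha=1}^{m-1}(-1)^{m+\alpha+1}\binom{m}{\alpha+1}\alpha^n$.
   Context: A tree $T$ is viewed as a $1$-dimensional cell complex (vertices and edges). The cubical complex $T^n$ has as cells the $n$-tuples $c=(c_1,\dots,c_n)$ where each $c_i$ is a vertex or an edge of $T$; the dimension of $c$ is the number of entries that are edges, and the boundary cells of $c$ are obtained by replacing some edge entries by one of their endpoints. The Stirling complex $\mathcal{S}tr(T,n)$ is the subcomplex of $T^n$ consisting of all $n$-tuples $c$ in which every vertex of $T$ occurs as an entry at least once. A wedge of $k$ copies of the $0$-sphere means a discrete space with $k+1$ points. *)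

(* Defs.v *)
From HB Require Import structures.
From mathcomp Require Import all_boot all_order all_algebra.
From mathcomp Require Import all_classical all_reals all_analysis.
From mathcomp Require Import wedge_sigT.

Set Implicit Arguments.
Unset Strict Implicit.
Unset Printing Implicit Defensive.

Import Order.TTheory GRing.Theory Num.Theory.
Import numFieldNormedType.Exports.

Local Open Scope classical_set_scope.
Local Open Scope ring_scope.

Section Homotopy.
Variable R : realType.

Definition unit_interval : set R := `[0, 1].

Definition homotopic (X Y : topologicalType) (f g : X -> Y) : Prop :=
  exists H : X * unit_interval -> Y,
    [/\ continuous H,
        forall x t, set_val t = 0 -> H (x, t) = f x
      & forall x t, set_val t = 1 -> H (x, t) = g x].

Definition homotopy_equivalent (X Y : topologicalType) : Prop :=
  exists (f : X -> Y) (g : Y -> X),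
    [/\ continuous f, continuous g,
        homotopic (g \o f) idfun & homotopic (f \o g) idfun].

End Homotopy.

Section Spheres.
Variable R : realType.

(* The norm that the library puts on row vectors is the max norm, whence the
   explicit Euclidean equation. *)
Definition euclidean_sphere (d : nat) : set 'rV[R]_d.+1 :=
  [set x | \sum_j x 0 j ^+ 2 = 1].
Arguments euclidean_sphere d _ : clear implicits.

Lemma delta_mx_euclidean_sphere (d : nat) :
  euclidean_sphere d (delta_mx 0 0 : 'rV[R]_d.+1).
Proof.
rewrite /euclidean_sphere /= (bigD1 ord0) //= big1 => [|j j0].
  by rewrite mxE !eqxx expr1n addr0.
by rewrite mxE (negPf j0) andbF expr0n.
Qed.

Definition sphere_pt (d : nat) : euclidean_sphere d :=
  SigSub (mem_set (delta_mx_euclidean_sphere d)).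

(* Meaningful for k > 0 only: the library's wedge of an empty family is the
   empty space, not a point. *)
Definition wedge_of_spheres (k d : nat) : topologicalType :=
  wedge (fun _ : 'I_k => sphere_pt d).

End Spheres.

Section Trees.
Variables (V : finType) (e : rel V).

Definition tree : Prop :=
  [/\ symmetric e, irreflexive e, forall x y, connect e x y
    & forall p : seq V, (2 < size p)%N -> ~ ucycle e p].

(* A cell of the tree is encoded by the set of its vertices: a singleton for a
   vertex, a pair of adjacent vertices for an edge. *)
Definition tree_cell (A : {set V}) : bool :=
  [exists v, A == [set v]%SET] ||
  [exists x, exists y, e x y && (A == [set x; y]%SET)].

Definition cubical_complex (n : nat) : {set {ffun 'I_n -> {set V}}} :=
  [set c : {ffun 'I_n -> {set V}} | [forall i, tree_cell (c i)]]%SET.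

Definition stirling_complex (n : nat) : {set {ffun 'I_n -> {set V}}} :=
  [set c in cubical_complex n | [forall v, exists i, c i == [set v]%SET]]%SET.

Lemma stirling_complex_face (n : nat) (c c' : {ffun 'I_n -> {set V}}) :
  c \in stirling_complex n -> c' \in cubical_complex n ->
  (forall i, c' i \subset c i) -> c' \in stirling_complex n.
Proof.
rewrite !inE => /andP[_ /forallP cv] /forallP cc' sc.
apply/andP; split; first exact/forallP.
apply/forallP => v; have /existsP[i /eqP ci] := cv v.
apply/existsP; exists i.
have := sc i; rewrite ci subset1 => /orP[//|/eqP c'0].
have := cc' i; rewrite c'0 => /orP[/existsP[w /eqP /setP/(_ w)]|].
  by rewrite !inE eqxx.
move=> /existsP[x /existsP[y /andP[_ /eqP /setP/(_ x)]]].
by rewrite !inE eqxx.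
Qed.

Variable R : realType.

(* Barycentric coordinates: a point of |T| is a function V -> R, so |T^n| sits
   in the product of n copies of R^V. As T is finite, the cell complex topology
   is the subspace topology. *)
Definition closed_cell (A : {set V}) : set (prod_topology (fun _ : V => R)) :=
  [set x | [/\ forall v, 0 <= x v, forall v, v \notin A -> x v = 0
             & \sum_v x v = 1]].

Definition realization (n : nat) (K : {set {ffun 'I_n -> {set V}}}) :
    set (prod_topology (fun _ : 'I_n => prod_topology (fun _ : V => R))) :=
  [set x | exists2 c, c \in K & forall i, closed_cell (c i) (x i)].

Definition stirling_space (n : nat) : topologicalType :=
  set_type (realization (stirling_complex n)).

End Trees.

Arguments closed_cell {V} R A _.
Arguments realization {V} R {n} K _.

Definition stirling_f (m n : nat) : int :=
  \sum_(1 <= a < m) (-1) ^+ (m + a + 1) * 'C(m, a + 1)%:Z * a%:Z ^+ n.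

(* Main.v *)
Require Import Defs.
From mathcomp Require Import all_boot all_order all_algebra.
From mathcomp Require Import all_classical all_reals all_analysis.
From mathcomp Require Import wedge_sigT.
From mathcomp Require Import zify ring lra.

(* For a set S of vertices let X_S(n) be the subcomplex of T^n of the cells in
   which every vertex of S occurs; X_V(n) is the Stirling complex. By induction
   on n, X_S(n) contains a collapsible subcomplex A such that all cells outside A
   have the top dimension n - |S|. A free face of a cube can be pushed in by a
   central projection, so |A| is contractible, and the contraction extends to
   a homotopy of the whole complex by stretching the remaining open cubes.
   Hence |X| is homotopy equivalent to |X| with |A| collapsed to a point, which
   is a wedge of spheres, one for each cell outside A. Collapses preserve the
   Euler characteristic, which satisfies
   e(n+1, s) = (1 - s) e(n, s) + s e(n, s-1) in terms of s = |S|; this recursion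
   gives the number of spheres. *)

Set Implicit Arguments.
Unset Strict Implicit.
Unset Printing Implicit Defensive.

Import Order.TTheory GRing.Theory Num.Theory.
Import numFieldNormedType.Exports.

(** * Collapses in finite posets *)

Section Collapse.
(* [classical_sets] shadows many lemma names of [finset]. *)
Import boot.fintype boot.finset.
Variables (P : finType) (le : rel P).
Implicit Types (K D : {set P}).

(** Two properties are needed at once: [A] has to be contractible and the cells outside it must
    share one dimension. The latter puts every proper face of a remaining cube into [A], so that
    each such cube becomes a full sphere once [A] is a point. The obstacle in the induction is that
    fixing the last entry at a vertex [v] of [S] gives the complex of [S - v], which is larger than
    that of [S] and whose collapsible part ends at an unrelated vertex. Two devices glue these
    slices: enough edges of [T] are cut to separate the vertices of [S], and the end of every
    collapse is moved to a common vertex. The cut edges produce the new top-dimensional cells.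
    Collapses, unlike contractions, glue combinatorially: collapses over the cells of one factor
    assemble into a collapse of the whole. The count then uses only the common sign of the cells
    outside [A] and the Euler characteristic 1 of [A]; it must also be shown positive, since the
    wedge of an empty family is empty. *)

Inductive collapse : {set P} -> {set P} -> Prop :=
| collapse_refl K : collapse K K
| collapse_step K K' a b : a \in K -> b \in K -> a != b -> le a b ->
    (forall c, c \in K -> le a c -> c = a \/ c = b) ->
    collapse (K :\ a :\ b) K' -> collapse K K'.

Lemma collapse_sub K K' : collapse K K' -> K' \subset K.
Proof.
elim=> // {}K {}K' a b _ _ _ _ _ _ IH.
apply: subset_trans IH _.
by rewrite subDset; apply/subsetP => x; rewrite !inE => /andP[_ ->]; rewrite orbT.
Qed.

Lemma collapse_trans K2 K1 K3 : collapse K1 K2 -> collapse K2 K3 -> collapse K1 K3.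
Proof.
elim=> // K K' a b aK bK ab lab h _ IH /IH; exact: collapse_step.
Qed.

(** No removed cell lies below a cell of [D], so each free pair stays free after [D] is added. *)
Lemma collapseU K K' D : (forall d, d \in D -> d \notin K) ->
  (forall a d, a \in K -> a \notin K' -> d \in D -> ~~ le a d) ->
  collapse K K' -> collapse (K :|: D) (K' :|: D).
Proof.
move=> dis nle cK; elim: cK dis nle => [*|{}K {}K' a b aK bK ab lab h cK IH dis nle].
  exact: collapse_refl.
have aK' : a \notin K'.
  by apply/negP => /(subsetP (collapse_sub cK)); rewrite !inE eqxx andbF.
apply: (@collapse_step _ _ a b); rewrite ?inE ?aK ?bK//.
- move=> c; rewrite !inE => /orP[|cD lac]; first exact: h.
  by have := nle a c aK aK' cD; rewrite lac.
- have -> : (K :|: D) :\ a :\ b = (K :\ a :\ b) :|: D.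
    apply/setP => x; rewrite !inE.
    have [xD|] := boolP (x \in D); last by rewrite !orbF.
    have xK := dis _ xD; rewrite !orbT !andbT.
    by apply/andP; split; apply: contraNneq xK => ->.
  apply: IH => [d /dis|x d]; first by rewrite !inE; apply: contra => /andP[_ /andP[]].
  by rewrite !inE => /andP[_ /andP[_]]; exact: nle.
Qed.

(* The patchwork principle of discrete Morse theory; the poset that [pi] maps
   to enters only through a rank function. *)
Lemma collapse_patch (Q : finType) (pi : P -> Q) (rk : Q -> nat) K K' :
  (forall x y, le x y -> pi x = pi y \/ (rk (pi x) < rk (pi y))%N) ->
  K' \subset K ->
  (forall x y, x \in K -> y \in K' -> le x y -> x \in K') ->
  (forall t, collapse [set x in K | pi x == t] [set x in K' | pi x == t]) ->
  collapse K K'.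
Proof.
move=> mono; have [N] := ubnP #|pi @: (K :\: K')|.
elim: N K => // N IH K leN sK dK fib.
have [E|[t0 t0P]] := set_0Vmem (pi @: (K :\: K')).
  suff -> : K = K' by exact: collapse_refl.
  apply/eqP; rewrite eqEsubset sK andbT; apply/subsetP => x xK.
  apply/negPn/negP => xK'; suff : pi x \in set0 by rewrite inE.
  by rewrite -E; apply: imset_f; rewrite inE xK' xK.
(* Fibres are treated from the top rank down. A cell outside [K'] in the top fibre lies below no
   cell of another fibre: that cell would have larger rank, hence lie in [K'], and [K'] is closed
   below in [K]. *)
pose t := [arg max_(t > t0 in pi @: (K :\: K')) rk t].
have [tP tmax] : t \in pi @: (K :\: K') /\
    forall t', t' \in pi @: (K :\: K') -> (rk t' <= rk t)%N.
  by rewrite /t; case: arg_maxnP.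
pose D := [set x in K | pi x != t].
pose Kt := [set x in K | pi x == t].
pose Kt' := [set x in K' | pi x == t].
have KE : K = Kt :|: D.
  by apply/setP => x; rewrite !inE -andb_orr orbN andbT.
apply: (@collapse_trans (Kt' :|: D)).
  rewrite {1}KE; apply: collapseU (fib t).
    by move=> d; rewrite !inE => /andP[_ /negPf ->]; rewrite andbF.
  move=> a d; rewrite !inE => /andP[aK /eqP at_]; rewrite at_ eqxx andbT => aK'.
  move=> /andP[dK' dt]; apply/negP => lad.
  have [E|] := mono _ _ lad; first by rewrite -E at_ eqxx in dt.
  rewrite at_ ltnNge => /negP; apply; apply: tmax; apply: imset_f.
  rewrite inE dK' andbT; apply/negP => dK2.
  by rewrite (dK _ _ aK dK2 lad) in aK'.
have sub1 : Kt' :|: D \subset K.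
  rewrite subUset; apply/andP; split; apply/subsetP => x; rewrite inE => /andP[].
    by move=> /(subsetP sK).
  by [].
apply: IH.
- rewrite ltnS in leN; apply: leq_trans leN; apply: proper_card; apply/properP; split.
    apply/subsetP => y /imsetP[x]; rewrite inE => /andP[xK' x1] ->.
    by apply: imset_f; rewrite inE xK' (subsetP sub1).
  exists t => //; apply/negP => /imsetP[x]; rewrite !inE => /andP[xK'].
  by rewrite (negPf xK') /= => /andP[_ /eqP xt] /esym.
- apply/subsetP => x xK'; rewrite !inE xK' (subsetP sK) //=.
  by rewrite orbN.
- by move=> x y /(subsetP sub1); exact: dK.
- move=> t'; have [->|t't] := eqVneq t' t.
    rewrite (_ : [set x in _ | _] = [set x in K' | pi x == t]); first exact: collapse_refl.
    apply/setP => x; rewrite !inE.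
    by case: eqP; rewrite ?andbF ?andbT ?orbF.
  rewrite (_ : [set x in _ | _] = [set x in K | pi x == t']); first exact: fib.
  apply/setP => x; rewrite !inE.
  by case: (pi x =P t') => [->|]; rewrite ?andbF // (negPf t't) andbF andbT.
Qed.

(** * Changing the vertex at which a collapse ends *)

Section Reroot.
Variable C : {set P}.
Hypothesis le_trans : transitive le.

Definition minimal_cell a := a \in C /\ forall c, c \in C -> le c a -> c = a.

Definition down_closed K :=
  K \subset C /\ forall x y, x \in C -> y \in K -> le x y -> x \in K.

Definition covers a b := [/\ a \in C, b \in C, a != b, le a b &
  forall c, c \in C -> le a c -> le c b -> c = a \/ c = b].

Lemma down_closed_step K a b : down_closed K -> le a b ->
  (forall c, c \in K -> le a c -> c = a \/ c = b) -> down_closed (K :\ a :\ b).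
Proof.
move=> [sK dK] lab h; split.
  by apply/subsetP => x; rewrite !inE => /andP[_ /andP[_ /(subsetP sK)]].
move=> x y xC; rewrite !inE => /andP[yb /andP[ya yK]] lxy.
rewrite (dK _ _ xC yK lxy) andbT.
have nay : ~~ le a y.
  by apply/negP => /h -/(_ yK)[] E; rewrite E eqxx in ya yb.
apply/andP; split; apply: contraNneq nay => E; rewrite E in lxy => //.
exact: le_trans lab lxy.
Qed.

(** Cells between [a] and [b] belong to [K] by closedness, so freeness leaves none. This is why
    [collapse] need not ask that the dimensions differ by one. *)
Lemma step_covers K a b : down_closed K -> a \in K -> b \in K -> a != b ->
  le a b -> (forall c, c \in K -> le a c -> c = a \/ c = b) -> covers a b.
Proof.
move=> [sK dK] aK bK ab lab h; split => //; try exact: (subsetP sK).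
by move=> c cC lac lcb; apply: h => //; exact: dK lcb.
Qed.

(** Induction along a collapse with closedness and the covering relation carried along; the end [L]
    is fixed. *)
Lemma collapse_ind_closed (Pr : {set P} -> Prop) L :
  (forall K a b, down_closed K -> a \in K -> b \in K -> covers a b ->
     (forall c, c \in K -> le a c -> c = a \/ c = b) ->
     Pr (K :\ a :\ b) -> Pr K) ->
  Pr L -> forall K, down_closed K -> collapse K L -> Pr K.
Proof.
move=> h PL K dK cK; elim: cK dK PL => // {}K {}L a b aK bK ab lab hh _ IH dK PL.
apply: (h K a b) => //; first exact: step_covers hh.
by apply: IH => //; exact: down_closed_step.
Qed.

(** The only feature of cubes that rerooting needs: an edge has exactly two ends. *)
Hypothesis edgeP : forall a b, minimal_cell a -> covers a b ->
  exists a', [/\ minimal_cell a', a' != a, le a' b &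
    forall c, c \in C -> le c b -> [\/ c = a, c = a' | c = b]].

(* If the root is not removed first, induct; otherwise it hangs on a free edge,
   and the collapse can be run towards the other end of that edge instead. *)
Lemma collapse_reroot K p q : down_closed K -> collapse K [set p] ->
  q \in K -> minimal_cell q -> collapse K [set q].
Proof.
move=> dK cK; move: q; move: K dK cK.
apply: (@collapse_ind_closed (fun K => forall q, q \in K -> minimal_cell q ->
  collapse K [set q])) => [K a b dK aK bK cab h IH q qK mq|q].
  have [_ bC ab lab _] := cab.
  have [qK0|] := boolP (q \in K :\ a :\ b).
    by apply: (@collapse_step _ _ a b) => //; exact: IH.
  rewrite !inE qK andbT negb_and !negbK => /orP[/eqP qb|/eqP qa].
    have [_ mb] := mq; move: (mb a); rewrite qb => /(_ _ lab) E.
    by rewrite E ?eqxx// in ab; case: cab.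
  rewrite {q qK}qa in mq *.
  have [a' [ma' a'a la'b hb]] := edgeP mq cab.
  have a'b : a' != b.
    apply: contraNneq ab => a'b; have [_ mb] := ma'.
    by apply/eqP; rewrite -[in RHS]a'b; apply: mb; [case: cab | rewrite a'b].
  have a'K : a' \in K by apply: dK.2 bK la'b; case: ma'.
  have -> : K = (K :\ a :\ b) :|: [set a; b].
    apply/setP => x; rewrite !inE.
    have [->|_] := eqVneq x a; first by rewrite aK orbT.
    by have [->|_] := eqVneq x b; [rewrite bK !orbT | rewrite !orbF].
  (* The rest is collapsed to the other end [a'] while [a] and [b] are kept; then [a'] is removed
     through [b] and [a] survives. *)
  apply: (@collapse_trans ([set a'] :|: [set a; b])).
    apply: collapseU (IH a' _ ma').
    - by move=> d; rewrite !inE => /orP[]/eqP->; rewrite eqxx ?andbF.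
    - move=> x d; rewrite !inE => /andP[xb /andP[xa xK]] xa'.
      have xC := subsetP dK.1 _ xK.
      move=> /orP[]/eqP->; apply/negP.
        by move=> /(mq.2 _ xC) E; rewrite E eqxx in xa.
      by move=> /(hb _ xC)[] E; rewrite E eqxx in xa xb xa'.
    - by rewrite !inE a'K a'a a'b.
  apply: (@collapse_step _ _ a' b); rewrite ?inE ?eqxx ?orbT//.
    move=> c; rewrite !inE => /or3P[]/eqP->; [by left| |by right].
    by move=> /(mq.2 _ ma'.1) E; rewrite E eqxx in a'a.
  rewrite (_ : _ :\ b = [set a]); first exact: collapse_refl.
  apply/setP => x; rewrite !inE.
  have [->|_] := eqVneq x b; first by rewrite [RHS]eq_sym (negPf ab).
  have [->|_] := eqVneq x a'; last by rewrite orbF.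
  by rewrite (negPf a'a).
by rewrite inE => /eqP -> _; exact: collapse_refl.
Qed.

(** The two terms of each removed pair cancel. For the sign of the dimension this is the invariance
    of the Euler characteristic. *)
Lemma collapse_sum (s : P -> int) K K' :
  (forall a b, covers a b -> s b = - s a)%R -> down_closed K -> collapse K K' ->
  (\sum_(c in K) s c = \sum_(c in K') s c)%R.
Proof.
move=> hs; move: K.
apply: (@collapse_ind_closed (fun K => \sum_(c in K) s c = \sum_(c in K') s c)%R) => //.
move=> K a b dK aK bK cab h <-.
have [_ _ ab _ _] := cab.
rewrite (big_setD1 a) //= (big_setD1 b) /=; last by rewrite !inE eq_sym ab.
by rewrite (hs _ _ cab) addrA subrr add0r.
Qed.

End Reroot.
End Collapse.

Section CollapseImage.
Import boot.fintype boot.finset.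

Lemma collapse_imset (P Q : finType) (leP : rel P) (leQ : rel Q) (f : P -> Q) K K' :
  injective f -> (forall x y, leQ (f x) (f y) = leP x y) ->
  collapse leP K K' -> collapse leQ (f @: K) (f @: K').
Proof.
move=> fI fle; elim=> [*|{}K {}K' a b aK bK ab lab h _ IH]; first exact: collapse_refl.
apply: (@collapse_step _ _ _ _ (f a) (f b)); rewrite ?imset_f ?(inj_eq fI) ?fle//.
  by move=> _ /imsetP[c cK ->]; rewrite fle => /(h _ cK)[] ->; [left|right].
rewrite (_ : _ :\ _ = f @: (K :\ a :\ b)) //.
apply/setP => y; rewrite !inE; apply/and3P/imsetP.
  move=> [yb ya /imsetP[x xK E]]; rewrite {y}E in ya yb *.
  by exists x => //; rewrite !inE xK -!(inj_eq fI) ya yb.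
move=> [x]; rewrite !inE => /and3P[xb xa xK] ->.
by rewrite !(inj_eq fI) imset_f.
Qed.

End CollapseImage.

(** * Trees *)

Section TreeCollapse.
Import boot.fintype boot.finset.
Variables (V : finType) (e : rel V).
Hypothesis treeE : tree e.

Definition tree_cells : {set {set V}} := [set A | tree_cell e A].

Definition subset_rel : rel {set V} := fun A B => A \subset B.

Lemma tree_cellP (A : {set V}) :
  reflect ((exists v, A = [set v]) \/ exists x y, e x y /\ A = [set x; y])
          (tree_cell e A).
Proof.
apply: (iffP orP) => -[].
- by move=> /existsP[v /eqP ->]; left; exists v.
- by move=> /existsP[x /existsP[y /andP[exy /eqP ->]]]; right; exists x, y.
- by move=> [v ->]; left; apply/existsP; exists v.
- by move=> [x [y [exy ->]]]; right; apply/existsP; exists x; apply/existsP; exists y;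
  rewrite exy eqxx.
Qed.

Lemma tree_edge_neq x y : e x y -> x != y.
Proof. by move=> exy; apply/eqP => E; case: treeE => _ irr _ _; rewrite E irr in exy. Qed.

Lemma tree_cell_card A : tree_cell e A -> #|A| = 1%N \/ #|A| = 2%N.
Proof.
move=> /tree_cellP[[v ->]|[x [y [exy ->]]]]; first by left; rewrite cards1.
by right; rewrite cards2 tree_edge_neq.
Qed.

Lemma tree_cell1 v : tree_cell e [set v].
Proof. by apply/tree_cellP; left; exists v. Qed.

Lemma tree_cell_neq0 A : tree_cell e A -> exists x, x \in A.
Proof.
by move=> /tree_cellP[[v ->]|[x [y [exy ->]]]]; [exists v|exists x]; rewrite !inE eqxx.
Qed.

Lemma tree_cell_proper A B : tree_cell e A -> tree_cell e B -> A \subset B ->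
  A != B -> exists x y, [/\ e x y, A = [set x] & B = [set x; y]].
Proof.
have [sym _ _ _] := treeE.
move=> cA /tree_cellP[[v ->]|[x [y [exy ->]]]] sAB nAB.
  have [x xA] := tree_cell_neq0 cA; move: sAB nAB; rewrite subset1 => /orP[/eqP->|/eqP A0].
    by rewrite eqxx.
  by rewrite A0 inE in xA.
have [card1|card2] := tree_cell_card cA.
  move/eqP/cards1P : card1 => [z Az]; move: sAB; rewrite Az sub1set !inE => /orP[]/eqP zE.
    by exists x, y; rewrite zE.
  by exists y, x; rewrite zE sym exy setUC.
move: nAB; rewrite eqEcard sAB card2 cards2; by case: (_ != _).
Qed.

(* Grow a connected vertex set from a root in [S], each new vertex hanging on a
   unique edge: cut that edge if the vertex is in [S], collapse it otherwise. *)
Lemma tree_forest (S : {set V}) : S != set0 ->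
  exists F : {set {set V}}, [/\ #|F|.+1 = #|S|, forall A, A \in F -> #|A| = 2%N &
    collapse subset_rel (tree_cells :\: F) [set [set v] | v in S]].
Proof.
have [sym irr conn nocyc] := treeE.
move=> /set0Pn[r rS].
pose relW (W : {set V}) := [rel x y | [&& x \in W, y \in W & e x y]].
pose CW (W : {set V}) := [set A in tree_cells | A \subset W].
suff H : forall k, (k < #|V|)%N -> exists W : {set V},
  [/\ #|W| = k.+1, r \in W, {in W &, forall x y, connect (relW W) x y} &
   exists F : {set {set V}}, [/\ #|F|.+1 = #|S :&: W|, F \subset CW W,
     forall A, A \in F -> #|A| = 2%N &
     collapse subset_rel (CW W :\: F) [set [set v] | v in S :&: W]]].
  have V0 : (0 < #|V|)%N by apply/card_gt0P; exists r.
  have [|W [cW rW _ [F [cF _ F2 cl]]]] := H #|V|.-1; first by rewrite prednK.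
  have WT : W = setT.
    by apply/eqP; rewrite eqEcard subsetT cardsT cW prednK ?leqnn.
  exists F; rewrite WT setIT in cF cl; split=> //.
  rewrite (_ : tree_cells = CW setT) //.
  by apply/setP => A; rewrite [in RHS]inE subsetT andbT.
elim=> [|k IH] kV.
  exists [set r]; rewrite cards1 inE eqxx; split=> //.
    by move=> x y; rewrite !inE => /eqP-> /eqP->; exact: connect0.
  exists set0; have -> : S :&: [set r] = [set r] by apply/setIidPr; rewrite sub1set.
  rewrite cards0 cards1 sub0set; split=> //; first by move=> A; rewrite inE.
  rewrite (_ : _ :\: _ = [set [set v] | v in [set r]]); first exact: collapse_refl.
  rewrite imset_set1 setD0; apply/setP => A; rewrite !inE subset1.
  have [->|_] := eqVneq A [set r]; first by rewrite tree_cell1.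
  apply/negbTE/negP => /andP[cA /eqP A0].
  by have [x] := tree_cell_neq0 cA; rewrite A0 inE.
have [W [cW rW cnW [F [cF sF F2 clF]]]] := IH (ltnW kV).
have [u [w [uW wW euw]]] : exists u w, [/\ u \in W, w \notin W & e u w].
  have [/existsP[u /existsP[w /and3P[? ? ?]]]|nex] :=
    boolP [exists u, exists w, [&& u \in W, w \notin W & e u w]]; first by exists u, w.
  have cle : fingraph.closed e W.
    apply: (intro_closed (sym_connect_sym sym)) => x y exy xW.
    apply/negPn/negP => yW; move/negP: nex; apply; apply/existsP; exists x.
    by apply/existsP; exists y; rewrite xW yW exy.
  have : W = setT.
    apply/setP => x; rewrite inE -[RHS]rW; apply/esym.
    exact: (closed_connect cle (conn r x)).
  by move=> WT; rewrite WT cardsT in cW; rewrite cW ltnn in kV.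
have wu : w != u by apply: contraNneq wW => ->.
(* A second neighbour of [w] in [W] would be joined to [u] by a simple path inside [W], which closes
   up to a cycle through [w]. *)
have uniqu u' : u' \in W -> e u' w -> u' = u.
  move=> u'W eu'w; apply/eqP/negPn/negP => nu.
  have /connectP[p0 pp0 lp0] := cnW _ _ uW u'W.
  move: lp0; case/shortenP: pp0 => p pp up _ lp.
  apply: (nocyc (w :: u :: p)).
    by case: (p) lp => //= E; rewrite E eqxx in nu.
  have pW : all (mem W) p.
    elim: (p) u pp {uW euw wu lp nu up}  => //= y q IHq x /andP[/and3P[_ yW _] /IHq ->].
    by rewrite yW.
  apply/andP; split; last first.
    rewrite cons_uniq up andbT inE negb_or wu /=.
    by apply: contra wW => /(allP pW).
  rewrite /= rcons_path -lp [e w u]sym euw eu'w andbT /=.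
  by apply: sub_path pp => x y /and3P[].
have wS : [set w] \notin CW W by rewrite !inE sub1set (negPf wW) andbF.
have uwS : [set u; w] \notin CW W.
  by rewrite !inE subUset !sub1set (negPf wW) !andbF.
have uw1 : [set w] != [set u; w].
  by apply/eqP => /setP/(_ u); rewrite !inE eqxx eq_sym (negPf wu).
have CWE : CW (w |: W) = CW W :|: [set [set w]; [set u; w]].
  apply/setP => A; rewrite !inE; apply/andP/orP.
    move=> [/tree_cellP[[v ->]|[x [y [exy ->]]]]].
      rewrite !sub1set !inE tree_cell1 => /orP[/eqP->|vW]; first by right; rewrite eqxx.
      by left.
    rewrite !subUset !sub1set !inE => /andP[/orP[/eqP xw|xW] /orP[/eqP yw|yW]].
    - by rewrite xw yw irr in exy.
    - right; rewrite xw in exy *; rewrite (uniqu y) ?[e y w]sym// setUC eqxx orbT //.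
    - by right; rewrite yw in exy *; rewrite (uniqu x) // eqxx orbT.
    - left; rewrite xW yW !andbT; apply/tree_cellP; right; by exists x, y.
  move=> [/andP[cA sA]|/orP[]/eqP->].
  - by split=> //; apply: subset_trans sA (subsetUr _ _).
  - by rewrite tree_cell1 sub1set !inE eqxx.
  - split; first by apply/tree_cellP; right; exists u, w.
    by rewrite subUset !sub1set !inE uW eqxx orbT.
have CWnot A : A \in CW W -> ~~ ([set w] \subset A).
  rewrite !inE sub1set => /andP[_ /subsetP sA].
  by apply: contra wW => /sA.
have FnW A : A \notin CW W -> A \notin F by apply: contra => /(subsetP sF).
exists (w |: W); split.
- by rewrite cardsU1 wW cW.
- by rewrite inE rW orbT.
- have up : subrel (connect (relW W)) (connect (relW (w |: W))).
    apply: connect_sub => x y /= /and3P[xW yW exy]; apply: connect1.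
    by rewrite /= !inE xW yW exy !orbT.
  have cw x : x \in W -> connect (relW (w |: W)) x w.
    move=> xW; apply: connect_trans (up _ _ (cnW _ _ xW uW)) _.
    by apply: connect1; rewrite /= !inE uW euw eqxx orbT.
  have symW : connect_sym (relW (w |: W)).
    apply: sym_connect_sym => x y /=; rewrite sym.
    by case: (x \in _); case: (y \in _).
  move=> x y; rewrite !inE => /orP[/eqP->|xW] /orP[/eqP->|yW].
  + exact: connect0.
  + by rewrite symW; exact: cw.
  + exact: cw.
  + exact: up (cnW _ _ xW yW).
have [wSS|wSS] := boolP (w \in S).
- exists ([set u; w] |: F).
  have SE : S :&: (w |: W) = w |: (S :&: W).
    by apply/setP => x; rewrite !inE; have [->|] := eqVneq x w; rewrite ?wSS.
  split.
  + by rewrite SE !cardsU1 FnW // inE (negPf wW) andbF !add1n cF.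
  + rewrite CWE; apply/subsetP => A; rewrite !inE => /orP[->|/(subsetP sF)].
      by rewrite !orbT.
    by rewrite !inE => ->.
  + by move=> A; rewrite !inE => /orP[/eqP->|/F2//]; rewrite cards2 eq_sym wu.
  rewrite (_ : _ :\: _ = (CW W :\: F) :|: [set [set w]]); last first.
    rewrite CWE; apply/setP => A; rewrite !inE negb_or.
    have [->|_] := eqVneq A [set w].
      by rewrite uw1 FnW//= !orbT.
    have [->|_] := eqVneq A [set u; w]; last by rewrite /= !orbF.
    by move: uwS; rewrite !inE => /negPf ->; rewrite andbF.
  rewrite SE imsetU1 [X in collapse _ _ X]setUC.
  apply: collapseU clF.
    move=> d; rewrite inE => /eqP->; by rewrite inE (negPf wS) andbF.
  move=> A d; rewrite in_setD => /andP[_ AC] _; rewrite inE => /eqP->.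
  apply/negP; rewrite /subset_rel subset1 => /orP[/eqP AE|/eqP A0].
    by rewrite -AE AC in wS.
  by move: AC; rewrite !inE => /andP[/tree_cell_neq0[x]]; rewrite A0 inE.
- exists F.
  have SE : S :&: (w |: W) = S :&: W.
    apply/setP => x; rewrite !inE; have [->|//] := eqVneq x w.
    by rewrite (negPf wSS).
  rewrite SE; split=> //.
    rewrite CWE; apply: subset_trans sF (subsetUl _ _).
  rewrite CWE; apply: (@collapse_step _ _ _ _ [set w] [set u; w]) => //.
  + by rewrite !inE eqxx FnW// orbT.
  + by rewrite !inE eqxx FnW// !orbT.
  + by rewrite /subset_rel sub1set !inE eqxx orbT.
  + move=> A; rewrite !inE => /andP[_ /orP[|/orP[]/eqP->]]; [|by left|by right].
    move=> /andP[h1 h2]; rewrite /subset_rel => h3.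
    by have := CWnot A; rewrite !inE h1 h2 h3 => /(_ isT).
  rewrite (_ : _ :\ _ = CW W :\: F) //.
  apply/setP => A; rewrite !inE.
  have [->|_] := eqVneq A [set w]; first by move: wS; rewrite !inE => /negPf ->; rewrite !andbF.
  have [->|_] := eqVneq A [set u; w]; first by move: uwS; rewrite !inE => /negPf ->; rewrite !andbF.
  by rewrite !orbF.
Qed.

(** For a single vertex the set of cut edges is empty. *)
Lemma tree_collapse r : collapse subset_rel tree_cells [set [set r]].
Proof.
have [|F [cF _]] := @tree_forest [set r]; first by apply/set0Pn; exists r; rewrite inE.
rewrite imset_set1; move: cF; rewrite cards1 => -[] /eqP; rewrite cards_eq0 => /eqP ->.
by rewrite setD0.
Qed.

Lemma subset_rel_trans : transitive subset_rel.
Proof. by move=> B A C; exact: subset_trans. Qed.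

Lemma tree_cells_closed : down_closed subset_rel tree_cells tree_cells.
Proof. by split. Qed.

Lemma tree_sum (r : V) : (\sum_(A in tree_cells) (-1) ^+ (#|A| == 2%N) = 1 :> int)%R.
Proof.
rewrite (collapse_sum subset_rel_trans _ tree_cells_closed (tree_collapse r)).
  by rewrite big_set1 cards1.
move=> a b [aC bC nab lab _].
have [||x [y [exy -> ->]]] := tree_cell_proper _ _ lab nab; rewrite ?inE in aC bC => //.
by rewrite cards1 cards2 tree_edge_neq.
Qed.

End TreeCollapse.

(** * The poset of cells of a power of a tree *)

Section CubicalPoset.
Import boot.fintype boot.finset.
Variables (V : finType) (e : rel V).
Hypothesis treeE : tree e.
Implicit Types S : {set V}.

Definition face_le n : rel {ffun 'I_n -> {set V}} :=
  fun c c' => [forall i, c i \subset c' i].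
Arguments face_le : clear implicits.

Definition cell_upd n (c : {ffun 'I_n -> {set V}}) i A : {ffun 'I_n -> {set V}} :=
  [ffun j => if j == i then A else c j].

Definition cell_dim n (c : {ffun 'I_n -> {set V}}) := #|[set i | #|c i| == 2%N]|.

Section FixedDimension.
Variable n : nat.
Implicit Types (a b c : {ffun 'I_n -> {set V}}).
Local Notation cub := (cubical_complex e n).
Local Notation le := (face_le n).

Lemma face_leP c c' : reflect (forall i, c i \subset c' i) (le c c').
Proof. exact: forallP. Qed.

Lemma cubP c : reflect (forall i, tree_cell e (c i)) (c \in cub).
Proof. by rewrite inE; exact: forallP. Qed.

Lemma face_le_refl : reflexive le.
Proof. by move=> c; apply/face_leP. Qed.

Lemma face_le_trans : transitive le.
Proof.
move=> b a c /face_leP ab /face_leP bc; apply/face_leP => i.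
exact: subset_trans (ab i) (bc i).
Qed.

Lemma cub_upd c i A : c \in cub -> tree_cell e A -> cell_upd c i A \in cub.
Proof. by move=> /cubP cC cA; apply/cubP => j; rewrite ffunE; case: ifP. Qed.

(** Replacing a single differing entry of [b] by that of [a] gives a cell in between; it is not [b],
    so it is [a], and all other entries agree. *)
Lemma covers_shape a b : covers le cub a b -> exists i x y,
  [/\ e x y, a i = [set x], b i = [set x; y] & forall j, j != i -> a j = b j].
Proof.
move=> [aC bC nab /face_leP lab h].
have /existsP[i nabi] : [exists i, a i != b i].
  rewrite -negb_forall; apply: contraNN nab => /forallP E.
  by apply/eqP/ffunP => i; exact/eqP.
have [x [y [exy aE bE]]] := tree_cell_proper treeE (cubP _ aC i) (cubP _ bC i) (lab i) nabi.
exists i, x, y; split=> // j ji.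
have [|||E|E] := h (cell_upd b i (a i)).
- by apply: cub_upd => //; apply: (cubP _ aC).
- by apply/face_leP => k; rewrite ffunE; case: eqP => [->|].
- apply/face_leP => k; rewrite ffunE; case: eqP => [->|] //.
- by rewrite -E ffunE (negPf ji).
- by move/ffunP/(_ i)/eqP : E; rewrite ffunE eqxx (negPf nabi).
Qed.

Lemma minimal_cellP c : minimal_cell le cub c <-> forall i, exists v, c i = [set v].
Proof.
split=> [[cC mc] i|h].
  have /tree_cellP[//|[x [y [exy cE]]]] := cubP _ cC i.
  have /ffunP/(_ i) : cell_upd c i [set x] = c.
    apply: mc; first by apply: cub_upd => //; exact: tree_cell1.
    apply/face_leP => j; rewrite ffunE; case: eqP => [->|] //.
    by rewrite cE sub1set !inE eqxx.
  by rewrite ffunE eqxx cE => <-; exists x.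
split; first by apply/cubP => i; have [v ->] := h i; exact: tree_cell1.
move=> c' /cubP c'C /face_leP lc; apply/ffunP => i; have [v cE] := h i.
have := lc i; rewrite cE subset1 => /orP[/eqP//|/eqP c0].
by have [x] := tree_cell_neq0 (c'C i); rewrite c0 inE.
Qed.

(** Supplies the hypothesis of [collapse_reroot]: the other end of the edge [b] differs from [a] in
    the one entry where [b] is an edge of [T]. *)
Lemma cub_edgeP a b : minimal_cell le cub a -> covers le cub a b ->
  exists a', [/\ minimal_cell le cub a', a' != a, le a' b &
    forall c, c \in cub -> le c b -> [\/ c = a, c = a' | c = b]].
Proof.
move=> ma cab; have [i [x [y [exy ai bi abj]]]] := covers_shape cab.
have /minimal_cellP ma' := ma.
exists (cell_upd a i [set y]); split.
- apply/minimal_cellP => j; rewrite ffunE; case: eqP => _; last exact: ma'.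
  by exists y.
- apply/eqP => /ffunP/(_ i); rewrite ffunE eqxx ai => /set1_inj yx.
  by have := tree_edge_neq treeE exy; rewrite yx eqxx.
- apply/face_leP => j; rewrite ffunE; case: eqP => [->|/eqP /abj -> //].
  by rewrite bi sub1set !inE eqxx orbT.
move=> c /cubP cC /face_leP lcb.
have cj j : j != i -> c j = a j.
  move=> ji; have := lcb j; rewrite -abj //; have [v ->] := ma' j.
  rewrite subset1 => /orP[/eqP//|/eqP c0].
  by have [z] := tree_cell_neq0 (cC j); rewrite c0 inE.
have cE A : c i = A -> c = cell_upd a i A.
  move=> E; apply/ffunP => j; rewrite ffunE; case: eqP => [->//|/eqP]; exact: cj.
have [E|nE] := eqVneq (c i) (b i).
  apply: Or33; apply/ffunP => j; have [->//|ji] := eqVneq j i.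
  by rewrite cj // abj.
have := lcb i; rewrite bi => lci.
have [_ /cubP bC _ _ _] := cab.
have [z [t [ezt ciE biE]]] := tree_cell_proper treeE (cC i) (bC i) (lcb i) nE.
have : z \in [set x; y] by rewrite -bi biE !inE eqxx.
rewrite !inE => /orP[]/eqP zE.
  apply: Or31; apply/ffunP => j; have [->|ji] := eqVneq j i; last exact: cj.
  by rewrite ai ciE zE.
by apply: Or32; apply: cE; rewrite ciE zE.
Qed.

Lemma covers_dim a b : covers le cub a b -> cell_dim b = (cell_dim a).+1.
Proof.
move=> /covers_shape [i [x [y [exy ai bi abj]]]].
rewrite /cell_dim (_ : [set _ | _] = i |: [set j | #|a j| == 2%N]).
  by rewrite cardsU1 inE ai cards1.
apply/setP => j; rewrite !inE; have [->|ji] := eqVneq j i; last by rewrite abj.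
by rewrite bi cards2 (tree_edge_neq treeE exy).
Qed.

(* For [S = V] this is the Stirling complex; the induction on [n] passes through
   all [S], since fixing the last coordinate at a vertex removes it from [S]. *)
Definition vertex_cover (S : {set V}) : {set {ffun 'I_n -> {set V}}} :=
  [set c in cub | [forall v in S, exists i, c i == [set v]]].

Lemma vertex_coverP S c : reflect (c \in cub /\ forall v, v \in S -> exists i, c i = [set v])
  (c \in vertex_cover S).
Proof.
rewrite [X in reflect _ X]inE; apply: (iffP andP) => -[cC h]; split=> //.
  by move=> v vS; have /existsP[i /eqP] := forall_inP h v vS; exists i.
by apply/forall_inP => v /h[i E]; apply/existsP; exists i; rewrite E.
Qed.

Lemma vertex_cover_closed S : down_closed le cub (vertex_cover S).
Proof.
split; first by apply/subsetP => c /vertex_coverP[].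
move=> x y xC /vertex_coverP[yC h] /face_leP lxy; apply/vertex_coverP; split=> //.
move=> v /h[i yi]; exists i; have := lxy i; rewrite yi subset1 => /orP[/eqP//|/eqP x0].
by have [z] := tree_cell_neq0 (cubP _ xC i); rewrite x0 inE.
Qed.

(** Distinct vertices of [S] occupy distinct coordinates, none of which is an edge. *)
Lemma vertex_cover_dim S c : c \in vertex_cover S -> (cell_dim c + #|S| <= n)%N.
Proof.
move=> /vertex_coverP[cC h].
pose D := [set i | #|c i| == 2%N].
have : (#|S| <= #|~: D|)%N.
  rewrite -(card_imset _ (@set1_inj V)).
  apply: leq_trans (leq_imset_card c (~: D)); apply: subset_leq_card.
  apply/subsetP => _ /imsetP[v /h[i ci] ->]; apply/imsetP; exists i => //.
  by rewrite !inE ci cards1.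
by move=> h1; have := cardsC D; rewrite card_ord /cell_dim -/D => h2; lia.
Qed.

Lemma vertex_coverS S S' : S \subset S' -> vertex_cover S' \subset vertex_cover S.
Proof.
move=> sS; apply/subsetP => c /vertex_coverP[cC h]; apply/vertex_coverP; split=> // v vS.
by apply: h; exact: (subsetP sS).
Qed.

End FixedDimension.
Arguments vertex_cover : clear implicits.

Lemma vertex_cover_neq0 n S : #|S| = n -> exists c, c \in vertex_cover n S.
Proof.
move=> Sn; pose f (i : 'I_n) : {set V} := [set enum_val (cast_ord (esym Sn) i)].
exists [ffun i => f i]; apply/vertex_coverP; split.
  by apply/cubP => i; rewrite ffunE; exact: tree_cell1.
move=> v vS; exists (cast_ord Sn (enum_rank_in vS v)).
by rewrite ffunE /f cast_ordK enum_rankK_in.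
Qed.

(** * Splitting off the last coordinate *)

Section CellExtension.
Variable n : nat.
Implicit Types (c : {ffun 'I_n -> {set V}}) (d : {ffun 'I_n.+1 -> {set V}}).

Definition cell_ext c (t : {set V}) : {ffun 'I_n.+1 -> {set V}} :=
  [ffun i => if unlift ord_max i is Some j then c j else t].

Definition cell_res d : {ffun 'I_n -> {set V}} := [ffun j => d (lift ord_max j)].

Lemma cell_ext_max c t : cell_ext c t ord_max = t.
Proof. by rewrite ffunE unlift_none. Qed.

Lemma cell_ext_lift c t j : cell_ext c t (lift ord_max j) = c j.
Proof. by rewrite ffunE liftK. Qed.

Lemma cell_extK c t : cell_res (cell_ext c t) = c.
Proof. by apply/ffunP => j; rewrite ffunE cell_ext_lift. Qed.

Lemma cell_resK d : cell_ext (cell_res d) (d ord_max) = d.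
Proof.
apply/ffunP => i; rewrite ffunE; case: unliftP => [j ->|->//].
by rewrite ffunE.
Qed.

Lemma forall_ext (Q : 'I_n.+1 -> Prop) :
  (forall i, Q i) <-> (forall j, Q (lift ord_max j)) /\ Q ord_max.
Proof.
split=> [h|[h1 h2] i]; first by split.
by case: (unliftP ord_max i) => [j ->|->].
Qed.

Lemma face_le_ext c t c' t' :
  face_le _ (cell_ext c t) (cell_ext c' t') = face_le _ c c' && (t \subset t').
Proof.
apply/face_leP/andP => [h|[/face_leP h1 h2]].
  split; last by have := h ord_max; rewrite !cell_ext_max.
  by apply/face_leP => j; have := h (lift ord_max j); rewrite !cell_ext_lift.
by apply/forall_ext; split=> [j|]; rewrite ?cell_ext_lift ?cell_ext_max.
Qed.

Lemma cub_ext c t :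
  (cell_ext c t \in cubical_complex e n.+1) = (c \in cubical_complex e n) && tree_cell e t.
Proof.
apply/cubP/andP => [h|[/cubP h1 h2]].
  split; last by have := h ord_max; rewrite !cell_ext_max.
  by apply/cubP => j; have := h (lift ord_max j); rewrite !cell_ext_lift.
by apply/forall_ext; split=> [j|]; rewrite ?cell_ext_lift ?cell_ext_max.
Qed.

Lemma cell_dim_ext c t : cell_dim (cell_ext c t) = (cell_dim c + (#|t| == 2))%N.
Proof.
rewrite /cell_dim -!sum1dep_card big_mkcond [in RHS]big_mkcond big_ord_recr /=.
congr (_ + _)%N; last by rewrite cell_ext_max; case: (_ == _).
apply: eq_bigr => i _; rewrite (_ : widen_ord _ i = lift ord_max i) ?cell_ext_lift //.
by apply: val_inj; rewrite /= /bump leqNgt ltn_ord.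
Qed.

(** The last entry serves a vertex of [S] only by being equal to it, and then it serves no other; an
    edge serves none. *)
Lemma vertex_cover_ext S c t : tree_cell e t -> (cell_ext c t \in vertex_cover n.+1 S) =
  if [pick v in S | t == [set v]] is Some v then c \in vertex_cover n (S :\ v)
  else c \in vertex_cover n S.
Proof.
move=> ct; case: pickP => [v /andP[vS /eqP tv]|nv].
- apply/vertex_coverP/vertex_coverP => -[]; rewrite cub_ext ct andbT => cC h; split=> // w.
    rewrite !inE => /andP[wv /h[i]]; case: (unliftP ord_max i) => [j ->|->].
      by rewrite cell_ext_lift; exists j.
    rewrite cell_ext_max tv => /set1_inj E; by rewrite E eqxx in wv.
  move=> wS; have [->|wv] := eqVneq w v; first by exists ord_max; rewrite cell_ext_max.
  have [|j cj] := h w; first by rewrite !inE wv wS.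
  by exists (lift ord_max j); rewrite cell_ext_lift.
- apply/vertex_coverP/vertex_coverP => -[]; rewrite cub_ext ct andbT => cC h; split=> // w wS.
    have [i] := h w wS; case: (unliftP ord_max i) => [j ->|->].
      by rewrite cell_ext_lift; exists j.
    by rewrite cell_ext_max => tw; have := nv w; rewrite wS tw eqxx.
  have [j cj] := h w wS.
  by exists (lift ord_max j); rewrite cell_ext_lift.
Qed.

End CellExtension.

End CubicalPoset.

(** * The collapsible subcomplex *)

Section CriticalCells.
Import boot.fintype boot.finset.
Variables (V : finType) (e : rel V).
Hypothesis treeE : tree e.
Implicit Types S : {set V}.

Local Notation cub n := (cubical_complex e n).

Lemma pick_vertex S (t : {set V}) v : v \in S -> t = [set v] ->
  [pick w in S | t == [set w]] = Some v.
Proof.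
move=> vS tv; case: pickP => [w /andP[wS /eqP]|/(_ v)]; last by rewrite vS tv eqxx.
by rewrite tv => /set1_inj ->.
Qed.

(** The total number of vertices in the entries is a rank, as [collapse_patch] requires: a proper
    face loses at least one. *)
Lemma rank_res n (x y : {ffun 'I_n.+1 -> {set V}}) : face_le x y ->
  cell_res x = cell_res y \/
  (\sum_i #|cell_res x i| < \sum_i #|cell_res y i|)%N.
Proof.
move=> /face_leP lxy.
have [->|nE] := eqVneq (cell_res x) (cell_res y); [by left|right].
have le i : (#|cell_res x i| <= #|cell_res y i|)%N.
  by rewrite !ffunE; exact: subset_leq_card.
rewrite ltn_neqAle leq_sum // andbT; apply: contraNneq nE => E.
have /leqif_sum[_] : forall i, true ->
    (#|cell_res x i| <= #|cell_res y i| ?= iff (#|cell_res x i| == #|cell_res y i|))%N.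
  by move=> i _; split.
move=> H; move/eqP: E; rewrite H => /forall_inP h.
apply/eqP/ffunP => i; apply/eqP; rewrite eqEcard.
by rewrite -(eqP (h i isT)) leqnn !ffunE lxy.
Qed.

Lemma rank_last n (x y : {ffun 'I_n.+1 -> {set V}}) : face_le x y ->
  x ord_max = y ord_max \/ (#|x ord_max| < #|y ord_max|)%N.
Proof.
move=> /face_leP/(_ ord_max) lxy.
have [->|nE] := eqVneq (x ord_max) (y ord_max); [by left|right].
by apply: proper_card; rewrite properEneq nE lxy.
Qed.

Lemma cell_ext_inj n (c : {ffun 'I_n -> {set V}}) : injective (cell_ext c).
Proof. by move=> t t' /ffunP/(_ ord_max); rewrite !cell_ext_max. Qed.

Lemma cell_ext_injl n (t : {set V}) : injective (fun c : {ffun 'I_n -> {set V}} => cell_ext c t).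
Proof. by move=> c c' E; rewrite -(cell_extK c t) E cell_extK. Qed.

Lemma fibre_res n (Q : {ffun 'I_n -> {set V}} -> {set V} -> bool) c :
  [set d in [set d : {ffun 'I_n.+1 -> {set V}} | Q (cell_res d) (d ord_max)] | cell_res d == c]
    = cell_ext c @: [set t | Q c t].
Proof.
apply/setP => d; rewrite !inE; apply/andP/imsetP.
  move=> [Qd /eqP E]; exists (d ord_max); first by rewrite inE -E.
  by rewrite -E cell_resK.
by move=> [t]; rewrite inE => Qt ->; rewrite cell_extK cell_ext_max.
Qed.

Lemma fibre_last n (Q : {ffun 'I_n -> {set V}} -> {set V} -> bool) t :
  [set d in [set d : {ffun 'I_n.+1 -> {set V}} | Q (cell_res d) (d ord_max)] | d ord_max == t]
    = (fun c => cell_ext c t) @: [set c | Q c t].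
Proof.
apply/setP => d; rewrite !inE; apply/andP/imsetP.
  move=> [Qd /eqP E]; exists (cell_res d); first by rewrite inE -E.
  by rewrite -E cell_resK.
by move=> [c]; rewrite inE => Qt ->; rewrite cell_extK cell_ext_max.
Qed.

(** Patchwork along the projection that forgets the last entry: collapses in the last factor over
    each fixed cell suffice. *)
Lemma collapse_res n (Q Q' : {ffun 'I_n -> {set V}} -> {set V} -> bool) :
  (forall c t, Q' c t -> Q c t) ->
  (forall c t c' t', Q c t -> Q' c' t' -> face_le c c' -> t \subset t' -> Q' c t) ->
  (forall c, collapse (@subset_rel V) [set t | Q c t] [set t | Q' c t]) ->
  collapse (@face_le V n.+1) [set d | Q (cell_res d) (d ord_max)]
                          [set d | Q' (cell_res d) (d ord_max)].
Proof.
move=> sQ dQ h; apply: (@collapse_patch _ _ _ (@cell_res V n) (fun c => \sum_i #|c i|)%N).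
- exact: rank_res.
- by apply/subsetP => d; rewrite !inE; exact: sQ.
- move=> x y; rewrite !inE => Qx Qy; rewrite -(cell_resK x) -(cell_resK y) face_le_ext.
  by move=> /andP[l1 l2]; rewrite cell_resK; exact: dQ l1 l2.
- move=> c; rewrite !fibre_res; apply: collapse_imset (h c); first exact: cell_ext_inj.
  by move=> t t'; rewrite face_le_ext face_le_refl.
Qed.

(** Patchwork along the last entry: collapses in the first [n] factors over each fixed cell of [T]
    suffice. *)
Lemma collapse_last n (Q Q' : {ffun 'I_n -> {set V}} -> {set V} -> bool) :
  (forall c t, Q' c t -> Q c t) ->
  (forall c t c' t', Q c t -> Q' c' t' -> face_le c c' -> t \subset t' -> Q' c t) ->
  (forall t, collapse (@face_le V n) [set c | Q c t] [set c | Q' c t]) ->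
  collapse (@face_le V n.+1) [set d | Q (cell_res d) (d ord_max)]
                          [set d | Q' (cell_res d) (d ord_max)].
Proof.
move=> sQ dQ h.
apply: (@collapse_patch _ _ _ (fun d : {ffun 'I_n.+1 -> {set V}} => d ord_max)
  (fun t : {set V} => #|t|)).
- exact: rank_last.
- by apply/subsetP => d; rewrite !inE; exact: sQ.
- move=> x y; rewrite !inE => Qx Qy; rewrite -(cell_resK x) -(cell_resK y) face_le_ext.
  by move=> /andP[l1 l2]; rewrite cell_resK; exact: dQ l1 l2.
- move=> t; rewrite !fibre_last; apply: collapse_imset (h t); first exact: cell_ext_injl.
  by move=> c c'; rewrite face_le_ext subxx andbT.
Qed.

Lemma minimal_ext n (p : {ffun 'I_n -> {set V}}) r :
  minimal_cell (@face_le V n) (cub n) p ->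
  minimal_cell (@face_le V n.+1) (cub n.+1) (cell_ext p [set r]).
Proof.
move=> /minimal_cellP h; apply/minimal_cellP; apply/forall_ext; split.
  by move=> j; rewrite cell_ext_lift.
by exists r; rewrite cell_ext_max.
Qed.

(** [B] shrinks to [p] over each cell of [T]; what is left is a copy of [T], which shrinks to
    [r]. *)
Lemma collapse_product n (B : {set {ffun 'I_n -> {set V}}}) p r :
  (forall c, c \in B -> face_le c p -> c = p) ->
  collapse (@face_le V n) B [set p] ->
  collapse (@face_le V n.+1)
    [set d | (cell_res d \in B) && tree_cell e (d ord_max)]
    [set cell_ext p [set r]].
Proof.
move=> mp cB; have pB : p \in B by rewrite (subsetP (collapse_sub cB)) ?inE.
apply: (@collapse_trans _ _ [set d | (cell_res d == p) && tree_cell e (d ord_max)]).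
  apply: (@collapse_last _ (fun c t => (c \in B) && tree_cell e t)
                          (fun c t => (c == p) && tree_cell e t)).
  - by move=> c t /andP[/eqP-> ->]; rewrite pB.
  - by move=> c t c' t' /andP[cB' ->] /andP[/eqP-> _] l _; rewrite (mp c) // eqxx.
  move=> t; case: (tree_cell e t).
    rewrite (_ : [set c | _] = B); last by apply/setP => c; rewrite inE andbT.
    rewrite (_ : [set c | (c == p) && _] = [set p]) //.
    by apply/setP => c; rewrite !inE andbT.
  rewrite (_ : [set c | _] = set0); last by apply/setP => c; rewrite !inE andbF.
  rewrite (_ : [set c | _] = set0); last by apply/setP => c; rewrite !inE andbF.
  exact: collapse_refl.
rewrite (_ : [set d | _] = cell_ext p @: tree_cells e); last first.
  apply/setP => d; rewrite !inE; apply/andP/imsetP.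
    by move=> [/eqP <- cd]; exists (d ord_max); rewrite ?cell_resK ?inE.
  by move=> [t]; rewrite inE => ct ->; rewrite cell_extK eqxx cell_ext_max.
rewrite -imset_set1; apply: collapse_imset (tree_collapse treeE r).
  exact: cell_ext_inj.
by move=> t t'; rewrite face_le_ext face_le_refl.
Qed.

Lemma cub_collapse n (r : V) : exists p, minimal_cell (@face_le V n) (cub n) p /\
  collapse (@face_le V n) (cub n) [set p].
Proof.
elim: n => [|n [p [mp cp]]].
  pose p : {ffun 'I_0 -> {set V}} := [ffun => set0].
  have pE c : c = p by apply/ffunP => -[].
  exists p; split; first by apply/minimal_cellP => -[].
  rewrite (_ : cub 0 = [set p]); first exact: collapse_refl.
  by apply/setP => c; rewrite (pE c) !inE eqxx; apply/forallP => -[].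
exists (cell_ext p [set r]); split; first exact: minimal_ext.
rewrite (_ : cub n.+1 = [set d | (cell_res d \in cub n) && tree_cell e (d ord_max)]).
  by apply: collapse_product cp => c cC; exact: mp.2.
by apply/setP => d; rewrite [in RHS]inE -cub_ext cell_resK.
Qed.

(** The invariant of the induction. The vertex [p] is arbitrary, since rerooting can move it. By
    [vertex_cover_dim] the last clause puts all cells outside [A] in the largest possible
    dimension. *)
Definition critical_pair n S (A : {set {ffun 'I_n -> {set V}}}) p :=
  [/\ A \subset vertex_cover e n S, down_closed (@face_le V n) (cub n) A,
      minimal_cell (@face_le V n) (cub n) p, collapse (@face_le V n) A [set p] &
      forall c, c \in vertex_cover e n S -> c \notin A -> (cell_dim c + #|S| = n)%N].

(** The dimension bound leaves only vertices, and any one of them can serve as [A]. *)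
Lemma critical_pair_points n S : #|S| = n -> exists A p, @critical_pair n S A p.
Proof.
move=> Sn; have [p pX] := vertex_cover_neq0 e Sn.
have dim0 c : c \in vertex_cover e n S -> cell_dim c = 0%N.
  by move=> /vertex_cover_dim; rewrite Sn; lia.
have mp : minimal_cell (@face_le V n) (cub n) p.
  apply/minimal_cellP => i; have /vertex_coverP[/cubP/(_ i) ci _] := pX.
  have [/eqP/cards1P//|c2] := tree_cell_card treeE ci.
  have /eqP := dim0 _ pX; rewrite /cell_dim cards_eq0 => /eqP/setP/(_ i).
  by rewrite !inE c2 eqxx.
exists [set p], p; split=> //.
- by rewrite sub1set.
- split; first by rewrite sub1set; case: mp.
  by move=> x y xC; rewrite !inE => /eqP-> /(mp.2 _ xC) ->.
- exact: collapse_refl.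
- by move=> c /dim0 -> _; rewrite Sn.
Qed.

(** Without vertices to cover, the complex is the whole of [T^n], which is collapsible and leaves no
    cell over. *)
Lemma critical_pair_empty n (r : V) : exists A p, @critical_pair n set0 A p.
Proof.
have [p [mp cp]] := cub_collapse n r.
exists (cub n), p; split=> //.
- by apply/subsetP => c cC; apply/vertex_coverP; split=> // v; rewrite inE.
- by move=> c /vertex_coverP[->].
Qed.

(* With [X] the complex of [S] in dimension [n], take
   [A' = B * T + X * (T - F) + \bigcup_(v in S) C v * {v}], where [B] and [C v]
   come from the induction hypothesis for [S] and [S - v]. Top-dimensionality of
   the cells missing from [C v] forces [X <= C v]. Then [A'] collapses first in
   the last coordinate, to [B * T + \bigcup_v C v * {v}], next over each cell of
   [T] to a common vertex [p], and finally [{p} * T] collapses to a point. *)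
Lemma critical_pair_step n S : S != set0 -> (#|S| <= n)%N ->
  (forall S', (#|S'| <= n)%N -> exists A p, @critical_pair n S' A p) ->
  exists A p, @critical_pair n.+1 S A p.
Proof.
move=> /[dup] S0 /set0Pn[r rS] Sn IH.
have [B [p [sB dB mp cB topB]]] := IH S Sn.
have [F [_ F2 cF]] := tree_forest treeE S0.
pose X := vertex_cover e n S.
have /choice[C CP] : forall v, exists C : {set {ffun 'I_n -> {set V}}},
    v \in S -> exists q, @critical_pair n (S :\ v) C q.
  move=> v; have [vS|] := boolP (v \in S); last by exists set0.
  have [|C [q h]] := IH (S :\ v); last by exists C => _; exists q.
  by apply: leq_trans Sn; rewrite (cardsD1 v S) leq_addl.
(* Cells of [X] have dimension at most [n - #|S|], cells missing from [C v] have dimension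
   [n - #|S| + 1]. *)
have XC v : v \in S -> X \subset C v.
  move=> vS; have [q [_ _ _ _ top]] := CP v vS.
  apply/subsetP => c cX; apply/negPn/negP => cC.
  have := vertex_cover_dim cX; have := top c _ cC; rewrite (cardsD1 v S) vS.
  by move=> /(_ (subsetP (vertex_coverS _ _ (subD1set _ _)) _ cX)); lia.
have BX : B \subset X by [].
have pB : p \in B by rewrite (subsetP (collapse_sub cB)) ?inE.
have dX := vertex_cover_closed e n S.
pose Sv t c := [exists v in S, (t == [set v]) && (c \in C v)].
have SvP t c : reflect (exists v, [/\ v \in S, t = [set v] & c \in C v]) (Sv t c).
  apply: (iffP exists_inP) => [[v vS /andP[/eqP tv cC]]|[v [vS -> cC]]]; first by exists v.
  by exists v; rewrite ?eqxx.
have Sv1 v c : v \in S -> Sv [set v] c = (c \in C v).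
  move=> vS; apply/SvP/idP => [[w [wS /set1_inj -> //]]|cC]; by exists v.
(* [Q] describes the complex [A'], and [Q1] what is left of it after the collapse in the last
   coordinate. *)
pose Q c t := tree_cell e t && [|| c \in B, (c \in X) && (t \notin F) | Sv t c].
pose Q1 c t := tree_cell e t && ((c \in B) || Sv t c).
have F1 v : [set v] \notin F by apply/negP => /F2; rewrite cards1.
have sub1 (t t' : {set V}) v : tree_cell e t -> t \subset t' -> t' = [set v] -> t = t'.
  move=> ct + t'v; rewrite t'v subset1 => /orP[/eqP//|/eqP t0].
  by have [z] := tree_cell_neq0 ct; rewrite t0 inE.
have SvC t c : Sv t c -> c \in cub n.
  move=> /SvP[v [vS _ cC]]; have [q [/subsetP sC _ _ _ _]] := CP v vS.
  by have /vertex_coverP[] := sC _ cC.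
have QC c t : Q c t -> c \in cub n.
  move=> /andP[_ /or3P[/(subsetP sB)|/andP[]|/SvC//]]; by move=> /vertex_coverP[].
have Sv_down c (t : {set V}) c' (t' : {set V}) :
    c \in cub n -> tree_cell e t -> face_le c c' -> t \subset t' ->
    Sv t' c' -> Sv t c.
  move=> cC ct lc lt /SvP[v [vS tv cCv]]; apply/SvP; exists v.
  have [q [_ [_ dC] _ _ _]] := CP v vS.
  by rewrite (sub1 _ _ v ct lt tv); split=> //; exact: dC lc.
have Q_down c (t : {set V}) c' (t' : {set V}) :
    c \in cub n -> tree_cell e t -> Q c' t' -> face_le c c' ->
    t \subset t' -> Q c t.
  move=> cC ct /andP[ct' h] lc lt; rewrite /Q ct /=.
  move: h => /or3P[c'B|/andP[c'X t'F]|h].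
  - by rewrite (dB.2 _ _ cC c'B lc).
  - rewrite (dX.2 _ _ cC c'X lc) /=.
    suff -> : t \notin F by rewrite orbT.
    have [->//|nt] := eqVneq t t'.
    have [x [y [_ -> _]]] := tree_cell_proper treeE ct ct' lt nt; exact: F1.
  - by rewrite (Sv_down _ _ _ _ cC ct lc lt h) !orbT.
exists [set d | Q (cell_res d) (d ord_max)], (cell_ext p [set r]).
have qE (d : {ffun 'I_n.+1 -> {set V}}) :
    d \in cub n.+1 = (cell_res d \in cub n) && tree_cell e (d ord_max).
  by rewrite -cub_ext cell_resK.
split.
- apply/subsetP => d; rewrite inE => /andP[ct h].
  rewrite -(cell_resK d) vertex_cover_ext //.
  case: pickP => [v /andP[vS /eqP tv]|nv].
    have XS := subsetP (vertex_coverS e n (subD1set S v)).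
    move: h => /or3P[/(subsetP BX)/XS//|/andP[/XS//]|].
    rewrite tv Sv1 //; have [q [/subsetP sC _ _ _ _]] := CP v vS; exact: sC.
  move: h => /or3P[/(subsetP BX)//|/andP[]//|/SvP[v [vS tv _]]].
  by have := nv v; rewrite vS tv eqxx.
- split; first by apply/subsetP => d; rewrite inE qE => /[dup] /QC -> /andP[->].
  move=> x y; rewrite qE => /andP[xC xt]; rewrite !inE => Qy.
  rewrite -{1}(cell_resK x) -{1}(cell_resK y) face_le_ext => /andP[lc lt].
  exact: (Q_down _ _ _ _ xC xt Qy lc lt).
- exact: minimal_ext.
- apply: (@collapse_trans _ _ [set d | Q1 (cell_res d) (d ord_max)]).
    apply: collapse_res.
    + by move=> c t /andP[ct /orP[h|h]]; rewrite /Q ct h ?orbT.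
    + move=> c t c' t' /[dup] /QC cC /andP[ct _] /andP[_ h] lc lt; rewrite /Q1 ct /=.
      move: h => /orP[c'B|h]; first by rewrite (dB.2 _ _ cC c'B lc).
      by rewrite (Sv_down _ _ _ _ cC ct lc lt h) orbT.
    + move=> c; have [cB'|cB'] := boolP (c \in B).
        rewrite (_ : [set t | Q c t] = [set t | Q1 c t]); first exact: collapse_refl.
        by apply/setP => t; rewrite !inE /Q /Q1 cB'.
      have [cX|cX] := boolP (c \in X); last first.
        rewrite (_ : [set t | Q c t] = [set t | Q1 c t]); first exact: collapse_refl.
        by apply/setP => t; rewrite !inE /Q /Q1 (negPf cX).
      (* For [c] in [X] outside [B], the fibre of [Q] is the cut tree. That of [Q1] is the set of
         vertices in [S], all of them because [c] lies in every [C v]. So [tree_forest] applies. *)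
      rewrite (_ : [set t | Q c t] = tree_cells e :\: F); last first.
        apply/setP => t; rewrite !inE /Q (negPf cB') cX /= andbC.
        case: (boolP (tree_cell e t)); rewrite ?andbF ?andbT //= => _.
        apply/orP/idP => [[//|/SvP[v [_ -> _]]//]|]; by left.
      rewrite (_ : [set t | Q1 c t] = [set [set v] | v in S]) //.
      apply/setP => t; rewrite !inE /Q1 (negPf cB') /=; apply/andP/imsetP.
        by move=> [_ /SvP[v [vS -> _]]]; exists v.
      move=> [v vS ->]; rewrite tree_cell1 Sv1 //; split=> //.
      exact: (subsetP (XC _ vS)).
  apply: (@collapse_trans _ _ [set d | (cell_res d == p) && tree_cell e (d ord_max)]).
    apply: (@collapse_last _ Q1 (fun c t => (c == p) && tree_cell e t)).
    + by move=> c t /andP[/eqP-> ct]; rewrite /Q1 ct pB.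
    + move=> c t c' t' /andP[ct h] /andP[/eqP-> _] lc _; rewrite ct andbT.
      apply/eqP; apply: mp.2 => //; move: h => /orP[/(subsetP sB)|/SvC//].
      by move=> /vertex_coverP[].
    + move=> t; have [ct|ct] := boolP (tree_cell e t); last first.
        rewrite (_ : [set c | _] = set0); last by apply/setP => c; rewrite !inE /Q1 (negPf ct).
        rewrite (_ : [set c | _] = set0); last by apply/setP => c; rewrite !inE andbF.
        exact: collapse_refl.
      rewrite (_ : [set c | (c == p) && _] = [set p]); last first.
        by apply/setP => c; rewrite !inE andbT.
      have [/existsP[v /andP[vS /eqP tv]]|nv] := boolP [exists v, (v \in S) && (t == [set v])].
        rewrite (_ : [set c | Q1 c t] = C v); last first.
          apply/setP => c; rewrite inE /Q1 ct tv Sv1 //=.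
          by apply/orP/idP => [[/(subsetP BX)/(subsetP (XC _ vS))//|//]|]; right.
        have [q [_ dC _ cC _]] := CP v vS.
        (* [C v] collapses to a vertex [q] of its own; it is rerooted at [p], which lies in [B],
           hence in [X] and in [C v]. *)
        apply: (collapse_reroot (@face_le_trans V n) (@cub_edgeP V e treeE n) dC cC _ mp).
        exact/(subsetP (XC _ vS))/(subsetP BX).
      rewrite (_ : [set c | Q1 c t] = B) //.
      apply/setP => c; rewrite inE /Q1 ct /=; case: (SvP _ _) => [[v [vS tv _]]|_];
        last by rewrite orbF.
      by move/existsP: nv; case; exists v; rewrite vS tv eqxx.
  have := @collapse_product n [set p] p r.
  rewrite (_ : [set d | (cell_res d \in [set p]) && _] =
      [set d | (cell_res d == p) && tree_cell e (d ord_max)]); last first.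
    by apply/setP => d; rewrite !inE.
  apply; last exact: collapse_refl.
  by move=> c; rewrite inE => /eqP.
(* A missing cell is either a cell missing from [C v] with last entry [v], or a cell of [X] outside
   [B] with a cut edge as last entry. In both cases its dimension is [n + 1 - #|S|]. *)
- move=> d dX'; rewrite inE => nQ.
  have ct : tree_cell e (d ord_max) by have /vertex_coverP[/cubP] := dX'.
  move: dX'; rewrite -{1 2}(cell_resK d) vertex_cover_ext // cell_dim_ext.
  case: pickP => [v /andP[vS /eqP tv]|nv] hX.
    have [q [_ _ _ _ top]] := CP v vS.
    have := top _ hX; rewrite tv cards1 (cardsD1 v S) vS => h.
    have := h _; rewrite -Sv1 // -tv; move: nQ; rewrite /Q ct /= => /or3P nQ.
    case: (SvP _ _) => [hs|_ /(_ isT)]; last by lia.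
    by case: nQ; apply: Or33; apply/SvP.
  move: nQ; rewrite /Q ct hX !negb_or /= => /and3P[nB tF _].
  by have := topB _ hX nB; rewrite (F2 _ (negbNE tF)) eqxx; lia.
Qed.

Lemma critical_complex n S : (0 < #|V|)%N -> (#|S| <= n)%N -> exists A p, @critical_pair n S A p.
Proof.
move=> /card_gt0P[r _]; elim: n S => [|n IH] S leSn.
  by apply: critical_pair_points; lia.
have [->|S0] := eqVneq S set0; first exact: critical_pair_empty.
have [Sn|nSn] := eqVneq #|S| n.+1; first exact: critical_pair_points.
by apply: critical_pair_step => //; lia.
Qed.

End CriticalCells.

(** * The Euler characteristic *)

Section EulerCharacteristic.
Import boot.fintype boot.finset.
Local Open Scope ring_scope.

(** In the last factor, the cells of [T] other than the [s] vertices of [S] have total sign [1 - s],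
    and over each of these vertices one vertex fewer is left to cover. For [s = 0] the truncated
    [s.-1] is multiplied by 0. *)
Fixpoint cover_euler (n s : nat) : int :=
  if n is n'.+1 then (1 - s%:Z) * cover_euler n' s + s%:Z * cover_euler n' s.-1
  else (s == 0)%N%:Z.

(* The number of spheres as it follows from the Euler characteristic. *)
Definition sphere_count (s n : nat) : int := (-1) ^+ (n + s) * (cover_euler n s - 1).

Lemma cover_euler0 n : cover_euler n 0 = 1.
Proof. by elim: n => //= n ->; rewrite mul0r addr0 subr0 mul1r. Qed.

Lemma cover_euler_lt n s : (n < s)%N -> cover_euler n s = 0.
Proof.
elim: n s => [|n IH] [|s] //= ns; rewrite !IH ?mulr0 ?addr0 //; lia.
Qed.

Lemma sphere_count0 n : sphere_count 0 n = 0.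
Proof. by rewrite /sphere_count cover_euler0 subrr mulr0. Qed.

(** The coefficients in the recursion of [cover_euler] add up to 1, so subtracting 1 preserves it;
    the sign factor makes all coefficients nonnegative. *)
Lemma sphere_countS s n :
  sphere_count s.+1 n.+1 = s%:Z * sphere_count s.+1 n + s.+1%:Z * sphere_count s n.
Proof.
rewrite /sphere_count /= !addnS !addSn !exprS.
have -> : s.+1%:Z = s%:Z + 1 by lia.
ring.
Qed.

(** The range includes [s = n + 1], where the complex is empty and the formula gives 1; below this
    boundary both terms of the recursion stay in range. For [s = 1] and positive [n] the count is 0,
    which only needs to be nonnegative. *)
Lemma sphere_count_gt0 s n : (1 < s)%N -> (s <= n.+1)%N -> 0 < sphere_count s n.
Proof.
elim: n s => [|n IH] [|[|s]] // _ sn.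
have [->|ns] := eqVneq n s.
  rewrite /sphere_count cover_euler_lt // sub0r (_ : (s.+1 + s.+2 = s.+1.*2.+1)%N); last by lia.
  by rewrite exprS -mul2n exprM sqrrN !expr1n.
rewrite sphere_countS; apply: ltr_wpDr; last by apply: mulr_gt0 => //; apply: IH; lia.
apply: mulr_ge0 => //; case: s sn ns => [|s] sn ns; last by apply: ltW; apply: IH; lia.
case: n {IH} sn ns => // n _ _; rewrite /sphere_count /= cover_euler0.
by rewrite subrr mul0r add0r mul1r subrr mulr0.
Qed.

(** The index [a = 0] is included to make the formula true at [n = 0], where its power is 1; for
    positive [n] that term vanishes. *)
Lemma sphere_count_sum s n :
  sphere_count s n = \sum_(a < s) (-1) ^+ (s + a + 1) * 'C(s, a + 1)%:Z * a%:Z ^+ n.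
Proof.
elim: n s => [|n IH] s.
  case: s => [|s]; first by rewrite big_ord0 sphere_count0.
  (* At [n = 0] the claim is the vanishing of the alternating sum of binomial coefficients, without
     its first term. *)
  have := exprDn (-1 : int) 1 s.+1; rewrite addNr expr0n /= => E.
  rewrite /sphere_count /= sub0r.
  have : \sum_(i < s.+2) (-1) ^+ (s.+1 + i) * 'C(s.+1, i)%:Z = 0 :> int.
    rewrite [RHS]E; apply: eq_bigr => i _; rewrite expr1n mulr1 -mulr_natr; congr (_ * _).
      have -> : (s.+1 + i = s.+1 - i + i.*2)%N by have := ltn_ord i; lia.
      by rewrite exprD -mul2n exprM sqrrN !expr1n mulr1.
    by rewrite natz.
  rewrite big_ord_recl /= addn0 bin0 mulr1 => /eqP; rewrite addr_eq0 => /eqP E2.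
  rewrite add0n E2 mulrN1 opprK; apply: eq_bigr => i _.
  by rewrite expr0 mulr1 !addn1 /bump /= add1n addnS.
case: s => [|s]; first by rewrite big_ord0 sphere_count0.
rewrite sphere_countS !IH.
have -> : \sum_(a < s) (-1) ^+ (s + a + 1) * 'C(s, a + 1)%:Z * a%:Z ^+ n =
          \sum_(a < s.+1) (-1) ^+ (s + a + 1) * 'C(s, a + 1)%:Z * a%:Z ^+ n :> int.
  by rewrite big_ord_recr /= bin_small ?addn1 // mulr0 mul0r addr0.
rewrite !mulr_sumr -big_split /=; apply: eq_bigr => a _.
rewrite !addn1; have := mul_bin_diag s.+1 a; rewrite /= => E.
have := binS s a => E2.
have {}E : s.+1%:Z * 'C(s, a)%:Z = a.+1%:Z * 'C(s.+1, a.+1)%:Z by rewrite -!PoszM E.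
have {}E2 : 'C(s.+1, a.+1)%:Z = 'C(s, a.+1)%:Z + 'C(s, a)%:Z by rewrite -PoszD E2.
(* Absorption and Pascal's rule combined: this is the recursion of [sphere_countS] read off at the
   coefficient of the power of [a]. *)
have E3 : a%:Z * 'C(s.+1, a.+1)%:Z = s%:Z * 'C(s.+1, a.+1)%:Z - s.+1%:Z * 'C(s, a.+1)%:Z.
  have -> : 'C(s, a.+1)%:Z = 'C(s.+1, a.+1)%:Z - 'C(s, a)%:Z by rewrite E2 addrK.
  rewrite mulrBr E; have -> : s.+1%:Z = s%:Z + 1 by lia.
  have -> : a.+1%:Z = a%:Z + 1 by lia.
  ring.
have -> : (-1) ^+ (s.+1 + a).+1 = - (-1) ^+ (s + a).+1 :> int.
  by rewrite !addSn exprS mulN1r.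
rewrite [_%:Z ^+ n.+1]exprS; apply/esym.
transitivity (- (-1) ^+ (s + a).+1 * (a%:Z * 'C(s.+1, a.+1)%:Z) * a%:Z ^+ n); first by ring.
by rewrite E3; ring.
Qed.

Lemma sphere_countE s n : (0 < n)%N -> sphere_count s n = stirling_f s n.
Proof.
move=> n0; rewrite sphere_count_sum /stirling_f.
case: s => [|s]; first by rewrite big_ord0 big_geq.
rewrite -(big_mkord xpredT (fun a => (-1) ^+ (s.+1 + a + 1) * 'C(s.+1, a + 1)%:Z * a%:Z ^+ n)).
by rewrite big_nat_recl //= -{1}(prednK n0) exprS mul0r mulr0 add0r big_add1.
Qed.

Variables (V : finType) (e : rel V).
Hypothesis treeE : tree e.
Hypothesis V0 : (0 < #|V|)%N.

Lemma vertex_cover_euler n (S : {set V}) :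
  \sum_(c in vertex_cover e n S) (-1) ^+ cell_dim c = cover_euler n #|S|.
Proof.
elim: n S => [|n IH] S.
  pose p : {ffun 'I_0 -> {set V}} := [ffun => set0].
  have pE c : c = p by apply/ffunP => -[].
  have [->|S0] := eqVneq S set0.
    rewrite cards0 /= (_ : vertex_cover _ _ _ = [set p]).
      by rewrite big_set1 /cell_dim eq_card0 // => -[].
    apply/setP => c; rewrite (pE c) [RHS]inE eqxx; apply/vertex_coverP; split.
      by apply/cubP => -[].
    by move=> v; rewrite inE.
  rewrite /= cards_eq0 (negPf S0) big1 // => c /vertex_coverP[_ h].
  by have /set0Pn[v /h[[]]] := S0.
rewrite (reindex (fun ct : {ffun 'I_n -> {set V}} * {set V} => cell_ext ct.1 ct.2)) /=; last first.
  exists (fun d => (cell_res d, d ord_max)) => [[c t] _|d _] /=.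
    by rewrite cell_extK cell_ext_max.
  exact: cell_resK.
rewrite big_mkcond /= -(pair_bigA _ (fun c t => if cell_ext c t \in vertex_cover e n.+1 S
   then (-1) ^+ cell_dim (cell_ext c t) else 0)) /= exchange_big /=.
pose E (T : {set V}) := cover_euler n #|T|.
(* Had every slice the Euler characteristic [E S], the sum would be [E S] times that of the tree,
   which is 1; [h] corrects the slices over the vertices of [S]. *)
pose h (t : {set V}) : int := if [pick v in S | t == [set v]] is Some v
  then E (S :\ v) - E S else 0.
transitivity (\sum_(t in tree_cells e) ((-1) ^+ (#|t| == 2%N) * E S + h t)).
  rewrite [RHS]big_mkcond /=; apply: eq_bigr => t _; rewrite inE.
  have [ct|nct] := boolP (tree_cell e t); last first.
    rewrite big1 // => c _; case: ifP => // /vertex_coverP[].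
    by rewrite cub_ext (negPf nct) andbF.
  rewrite -big_mkcond /=.
  under eq_bigr => c _ do rewrite cell_dim_ext exprD.
  rewrite -mulr_suml; under eq_bigl => c do rewrite vertex_cover_ext //.
  rewrite /h; case: pickP => [v /andP[vS /eqP tv]|nv]; rewrite IH.
    by rewrite tv cards1 /= mulr1 mul1r addrC subrK.
  by rewrite addr0 mulrC.
have [r _] := card_gt0P V0.
rewrite big_split /= -mulr_suml (tree_sum treeE r) mul1r.
rewrite (_ : \sum_(t in _) h t = \sum_(v in S) (cover_euler n #|S|.-1 - E S)).
  rewrite sumr_const -mulr_natl /E natz; ring.
transitivity (\sum_(t in [set [set v] | v in S]) h t).
  rewrite (big_setID [set [set v] | v in S]) /= [X in _ + X]big1 ?addr0.
    apply: eq_bigl => t; rewrite inE andbC; case: imsetP => // -[v _ ->] /=.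
    by rewrite inE tree_cell1.
  move=> t; rewrite inE => /andP[tS _]; rewrite /h; case: pickP => // v /andP[vS /eqP tv].
  by case/negP: tS; rewrite tv imset_f.
rewrite big_imset /=; last by move=> v w _ _; exact: set1_inj.
by apply: eq_bigr => v vS; rewrite /h (pick_vertex vS) // /E (cardsD1 v S) vS.
Qed.

(** [A] contributes the 1 of a single point, and every other cell the same sign, that of
    [n - #|S|]. *)
Lemma critical_count n S A p : critical_pair e S A p -> (#|S| <= n)%N ->
  (0 < n)%N -> #|vertex_cover e n S :\: A|%:Z = stirling_f #|S| n.
Proof.
move=> [sA dA mp cA top] Sn n0; rewrite -sphere_countE // /sphere_count -vertex_cover_euler.
have sign (a b : {ffun 'I_n -> {set V}}) : covers (@face_le V n) (cubical_complex e n) a b ->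
    (-1) ^+ cell_dim b = - (-1) ^+ cell_dim a :> int.
  by move=> /(covers_dim treeE) ->; rewrite exprS mulN1r.
rewrite (big_setID A) /= (setIidPr sA).
rewrite (collapse_sum (@face_le_trans V n) sign dA cA) big_set1.
have -> : cell_dim p = 0%N.
  apply/eqP; rewrite cards_eq0; apply/eqP/setP => i; rewrite !inE.
  by have [v ->] := (minimal_cellP e p).1 mp i; rewrite cards1.
rewrite expr0 addrAC subrr add0r.
under eq_bigr => c.
  rewrite inE => /andP[cA' cX]; have dc : cell_dim c = (n - #|S|)%N.
    by have := top c cX cA'; lia.
  rewrite dc; over.
rewrite sumr_const mulrnAr -exprD (_ : (n + #|S| + (n - #|S|) = n.*2)%N); last by lia.
by rewrite -mul2n exprM sqrrN !expr1n natz.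
Qed.

End EulerCharacteristic.

(** * Continuity and contractions *)

Section Continuity.
Local Open Scope classical_set_scope.
Local Open Scope ring_scope.

Lemma prod_topology_continuous (X : topologicalType) (I : Type) (K : I -> topologicalType)
    (f : X -> prod_topology K) :
  (forall i, continuous (fun x => f x i)) -> continuous f.
Proof.
move=> h x; apply/cvg_sup => i W [U [[U' oU' <-] U'fx sU]].
apply: (filterS sU); apply: (h i x); exact: open_nbhs_nbhs.
Qed.

Lemma matrix_continuous (X : topologicalType) (T : topologicalType) (m n : nat)
    (f : X -> 'M[T]_(m, n)) :
  (forall i j, continuous (fun x => f x i j)) -> continuous f.
Proof.
move=> h x W [P nP sP]; apply: (filterS sP).
apply: filter_forall => i; apply: filter_forall => j.
exact: h (nP i j).
Qed.

Lemma pair_continuous (X Y Z : topologicalType) (f : X -> Y) (g : X -> Z) :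
  continuous f -> continuous g -> continuous (fun x => (f x, g x)).
Proof. by move=> cf cg x; exact: (cvg_pair (cf x) (cg x)). Qed.

Lemma comp_continuous (X Y Z : topologicalType) (f : X -> Y) (g : Y -> Z) :
  continuous f -> continuous g -> continuous (fun x => g (f x)).
Proof. by move=> cf cg x; apply: continuous_comp; [exact: cf | exact: cg]. Qed.

Lemma fst_continuous (X Y : topologicalType) : continuous (@fst X Y).
Proof. by move=> x; exact: cvg_fst. Qed.

Lemma snd_continuous (X Y : topologicalType) : continuous (@snd X Y).
Proof. by move=> x; exact: cvg_snd. Qed.

Lemma within_comp (X Y Z : topologicalType) (A : set X) (B : set Y) (g : X -> Y) (F : Y -> Z) :
  {within B, continuous F} -> {within A, continuous g} -> (forall x, A x -> B (g x)) ->
  {within A, continuous (fun x => F (g x))}.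
Proof.
move=> /subspace_continuousP cF /subspace_continuousP cg h.
apply/subspace_continuousP => x Ax; apply: cvg_comp (cF _ (h _ Ax)).
move=> W WB; have := cg x Ax _ WB; apply: filterS2 (withinT A (nbhs_filter x)).
by move=> y Ay /= hy; apply: hy; exact: h.
Qed.

Lemma within_eq (X Y : topologicalType) (A : set X) (f g : X -> Y) :
  (forall x, A x -> f x = g x) -> {within A, continuous f} -> {within A, continuous g}.
Proof.
move=> h; apply: subspace_eq_continuous => x; rewrite inE; exact: h.
Qed.

Lemma finite_cover_cons (X : Type) (I : eqType) (i : I) (s : seq I) (A : I -> set X) :
  [set x | exists2 j, j \in i :: s & A j x] = A i `|` [set x | exists2 j, j \in s & A j x].
Proof.
apply/seteqP; split=> x.
  by move=> [j]; rewrite inE => /orP[/eqP->|js Aj]; [left|right; exists j].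
by move=> [Ai|[j js Aj]]; [exists i; rewrite ?inE ?eqxx|exists j; rewrite ?inE ?js ?orbT].
Qed.

Lemma closed_finite_cover (X : topologicalType) (I : eqType) (s : seq I) (A : I -> set X) :
  (forall i, i \in s -> closed (A i)) -> closed [set x | exists2 i, i \in s & A i x].
Proof.
elim: s => [|i s IH] cA.
  by rewrite (_ : [set x | _] = set0); [exact: closed0 | rewrite -subset0 => x []].
rewrite finite_cover_cons; apply: closedU; first by apply: cA; rewrite inE eqxx.
by apply: IH => j js; apply: cA; rewrite inE js orbT.
Qed.

Lemma within_finite_cover (X Y : topologicalType) (I : eqType) (s : seq I) (A : I -> set X)
    (f : X -> Y) :
  (forall i, i \in s -> closed (A i)) -> (forall i, i \in s -> {within A i, continuous f}) ->
  {within [set x | exists2 i, i \in s & A i x], continuous f}.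
Proof.
elim: s => [|i s IH] cA cf.
  rewrite (_ : [set x | _] = set0); last by rewrite -subset0 => x [].
  exact: continuous_subspace0.
rewrite finite_cover_cons; apply: withinU_continuous.
- by apply: cA; rewrite inE eqxx.
- by apply: closed_finite_cover => j js; apply: cA; rewrite inE js orbT.
- by apply: cf; rewrite inE eqxx.
- by apply: IH => j js; [apply: cA|apply: cf]; rewrite inE js orbT.
Qed.

Variable R : realType.
Section RealValued.
Variable T : topologicalType.
Implicit Types f g : T -> R.

Lemma cts_cst (c : R) : continuous (fun _ : T => c).
Proof. by move=> x; exact: cvg_cst. Qed.

Lemma cts_add f g : continuous f -> continuous g -> continuous (fun x => f x + g x).
Proof. by move=> cf cg x; exact: cvgD (cf x) (cg x). Qed.

Lemma cts_sub f g : continuous f -> continuous g -> continuous (fun x => f x - g x).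
Proof. by move=> cf cg x; exact: cvgB (cf x) (cg x). Qed.

Lemma cts_mul f g : continuous f -> continuous g -> continuous (fun x => f x * g x).
Proof. by move=> cf cg x; exact: cvgM (cf x) (cg x). Qed.

Lemma cts_div f g : (forall x, g x != 0) -> continuous f -> continuous g ->
  continuous (fun x => f x / g x).
Proof. by move=> g0 cf cg; apply: cts_mul => // x; exact: cvgV (g0 x) (cg x). Qed.

Lemma cts_norm f : continuous f -> continuous (fun x => `|f x|).
Proof. by move=> cf x; exact: cvg_norm (cf x). Qed.

Lemma cts_max f g : continuous f -> continuous g -> continuous (fun x => Num.max (f x) (g x)).
Proof. by move=> cf cg x; exact: (@continuous_max R T f g x (cf x) (cg x)). Qed.

Lemma cts_min f g : continuous f -> continuous g -> continuous (fun x => Num.min (f x) (g x)).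
Proof. by move=> cf cg x; exact: (@continuous_min R T f g x (cf x) (cg x)). Qed.

Lemma cts_sum (I : Type) (s : seq I) (f : I -> T -> R) :
  (forall i, continuous (f i)) -> continuous (fun x => \sum_(i <- s) f i x).
Proof.
move=> cf; elim: s => [|i s IH].
  by under eq_fun do rewrite big_nil; exact: cts_cst.
by under eq_fun do rewrite big_cons; exact: cts_add.
Qed.

Lemma cts_bigmax (I : Type) (s : seq I) (f : I -> T -> R) :
  (forall i, continuous (f i)) -> continuous (fun x => \big[Num.max/0]_(i <- s) f i x).
Proof.
move=> cf; elim: s => [|i s IH].
  by under eq_fun do rewrite big_nil; exact: cts_cst.
by under eq_fun do rewrite big_cons; exact: cts_max.
Qed.

End RealValued.
End Continuity.

Section Contractibility.
Local Open Scope classical_set_scope.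
Local Open Scope ring_scope.
Variables (R : realType) (E : topologicalType).
Implicit Types A X : set E.
Local Notation I := (`[(0:R), 1]%classic).

Lemma closed_set1R (r : R) : closed [set r].
Proof. by apply: accessible_closed_set1; apply: hausdorff_accessible; exact: Rhausdorff. Qed.

(** [H] is total and constrained only over [A] and the unit interval, so that homotopies can be
    composed without subtypes. The point [p] may move during the contraction. *)
Definition contraction A (H : E * R -> E) (p : E) :=
  [/\ A p, {within A `*` I, continuous H},
      forall x t, A x -> 0 <= t <= 1 -> A (H (x, t)),
      forall x, A x -> H (x, 0) = x & forall x, A x -> H (x, 1) = p].

(** At time 0 the contraction is the identity, so it can be continued by the identity to points
    outside [A], with continuity on a union of two closed sets. *)
Definition extend_at0 (H : E * R -> E) (z : E * R) := if z.2 == 0 then z.1 else H z.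

Lemma closed_setX (X Y : topologicalType) (A : set X) (B : set Y) :
  closed A -> closed B -> closed (A `*` B).
Proof.
move=> cA cB; have -> : A `*` B = (@fst X Y @^-1` A) `&` (@snd X Y @^-1` B) by [].
by apply: closedI; apply: closed_comp => // z _; [exact: fst_continuous|exact: snd_continuous].
Qed.

Lemma extend_at0_continuous A H p : closed A -> contraction A H p ->
  {within (A `*` I) `|` (setT `*` [set 0]), continuous (extend_at0 H)}.
Proof.
move=> cA [_ cH _ H0 _]; apply: withinU_continuous.
- by apply: closed_setX => //; exact: itv_closed.
- by apply: closed_setX; [exact: closedT | exact: closed_set1R].
- apply: within_eq cH => -[x t] [/= Ax _]; rewrite /extend_at0 /=.
  by case: eqP => // ->; rewrite H0.
- apply: (@within_eq _ _ _ fst); last exact/continuous_subspaceT/fst_continuous.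
  by move=> [x t] [_ /= ->]; rewrite /extend_at0 /= eqxx.
Qed.

(* [H] is only continuous on [A], so the concatenation of [D] with [H] is written
   as one composition with [extend_at0 H]. *)
Lemma contraction_retract A X H p (D : E * R -> E) : closed A -> A `<=` X ->
  contraction A H p -> {within X `*` I, continuous D} ->
  (forall x t, X x -> 0 <= t <= 1 -> X (D (x, t))) ->
  (forall x, X x -> D (x, 0) = x) -> (forall x, X x -> A (D (x, 1))) ->
  exists H', contraction X H' p.
Proof.
move=> cA AX cH cD DX D0 D1.
(* In the first half [D] runs at double speed while the clock of [H] stands at 0; in the second half
   [D] rests at time 1 and the clock of [H] runs. *)
pose th (z : E * R) := (D (z.1, Num.min 1 (2 * z.2)), Num.max 0 (2 * z.2 - 1)).
have thP x t : X x -> 0 <= t <= 1 ->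
    (th (x, t)).2 = 0 \/ [/\ 1 <= 2 * t, A (th (x, t)).1 & 0 <= (th (x, t)).2 <= 1].
  move=> Xx /andP[t0 t1]; rewrite /th /=.
  have [h|h] := leP (2 * t - 1) 0; [by left|right].
  rewrite min_l; last by lra.
  by split; [lra | exact: D1 | lra].
have thX x t : X x -> 0 <= t <= 1 -> X (th (x, t)).1.
  move=> Xx /andP[t0 t1]; apply: DX => //; rewrite le_min ge_min lexx /=; lra.
have [Ap _ HA H0 H1] := cH.
exists (fun z => extend_at0 H (th z)); split.
- exact: AX.
- apply: (within_comp (extend_at0_continuous cA cH)).
    apply: pair_continuous.
      apply: (within_comp cD).
        apply/continuous_subspaceT/pair_continuous; first exact: fst_continuous.
        apply: cts_min; first exact: cts_cst.
        by apply: cts_mul; [exact: cts_cst | exact: snd_continuous].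
      move=> [x t] [/= Xx]; rewrite in_itv /= => /andP[t0 t1]; split=> //=.
      by rewrite in_itv /= le_min ge_min lexx /=; lra.
    apply/continuous_subspaceT/cts_max; first exact: cts_cst.
    apply: cts_sub; last exact: cts_cst.
    by apply: cts_mul; [exact: cts_cst | exact: snd_continuous].
  move=> [x t] [/= Xx]; rewrite in_itv /= => tI.
  have [h|[_ h1 h2]] := thP _ _ Xx tI; first by right.
  by left; split=> //=; rewrite in_itv.
- move=> x t Xx tI; rewrite /extend_at0; case: eqP => [_|h]; first exact: thX.
  have [//|[_ h1 h2]] := thP _ _ Xx tI.
  by apply: AX; rewrite [th _]surjective_pairing; exact: HA.
- move=> x Xx; rewrite /extend_at0 /th /= mulr0 sub0r max_l ?eqxx ?lerN10 // min_r //.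
  exact: D0.
- move=> x Xx; rewrite /extend_at0 /th /= mulr1 min_l ?ler1n //.
  have -> : 2 - 1 = 1 :> R by lra.
  by rewrite max_r ?ler01 // oner_eq0 H1 //; exact: D1.
Qed.

End Contractibility.

(** * Barycentric coordinates on the cells of a tree *)

Section CellGeometry.
Local Open Scope ring_scope.
Import boot.fintype boot.finset.
Variables (V : finType) (e : rel V) (R : realType).
Hypothesis treeE : tree e.
Implicit Types (A B : {set V}) (y z : V -> R).

Definition cell_mid A (v : V) : R := (v \in A)%:R / #|A|%:R.

(* On an edge this is the distance to the midpoint, normalised to be 1 at both
   ends; on a vertex it vanishes. *)
Definition cell_dist A y : R := \sum_v `|y v - cell_mid A v|.

Definition affine_in A y := (forall v, v \notin A -> y v = 0) /\ \sum_v y v = 1.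

(** The homothety of ratio [l] centred at the barycentre. *)
Definition cell_scale A (l : R) y v := cell_mid A v + (y v - cell_mid A v) * l.

Lemma sum_vertex (f : V -> R) a : (forall v, v != a -> f v = 0) -> \sum_v f v = f a.
Proof. by move=> h; rewrite (bigD1 a) //= big1 ?addr0. Qed.

Lemma sum_edge (f : V -> R) a b : a != b -> (forall v, v != a -> v != b -> f v = 0) ->
  \sum_v f v = f a + f b.
Proof.
move=> ab h; rewrite (bigD1 a) //= (bigD1 b) 1?eq_sym //= big1 ?addr0 //.
by move=> v /andP[va vb]; exact: h.
Qed.

Lemma affine_vertexP a y : affine_in [set a] y <-> (forall v, y v = (v == a)%:R).
Proof.
split=> [[y0 ys] v|h].
  have hz w : w != a -> y w = 0 by move=> wa; apply: y0; rewrite inE.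
  by have [->|va] := eqVneq v a; [rewrite -ys (sum_vertex hz) | rewrite hz].
split=> [v|]; first by rewrite inE h => /negPf ->.
by rewrite (@sum_vertex _ a) => [|v /negPf]; rewrite h ?eqxx // => ->.
Qed.

Lemma affine_edgeP a b y : a != b ->
  affine_in [set a; b] y <-> (forall v, v != a -> v != b -> y v = 0) /\ y a + y b = 1.
Proof.
move=> ab; split=> [[y0 ys]|[h ys]].
  have hz w : w != a -> w != b -> y w = 0.
    by move=> wa wb; apply: y0; rewrite !inE negb_or wa.
  by split=> //; rewrite -ys (sum_edge ab hz).
split=> [v|]; last by rewrite (sum_edge ab).
by rewrite !inE negb_or => /andP[]; exact: h.
Qed.

Lemma cell_dist_vertex a y : affine_in [set a] y -> cell_dist [set a] y = 0.
Proof.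
move=> /affine_vertexP h; apply: big1 => v _.
by rewrite h /cell_mid inE cards1 divr1 subrr normr0.
Qed.

Lemma cell_dist_edge a b y : a != b -> affine_in [set a; b] y ->
  cell_dist [set a; b] y = `|2 * y a - 1|.
Proof.
move=> ab /(affine_edgeP _ ab)[h ys].
have m0 v : v != a -> v != b -> cell_mid [set a; b] v = 0.
  by move=> /negPf va /negPf vb; rewrite /cell_mid !inE va vb mul0r.
have m1 v : v \in [set a; b] -> cell_mid [set a; b] v = 2^-1.
  by move=> hv; rewrite /cell_mid hv cards2 ab div1r.
rewrite /cell_dist (@sum_edge _ a b) //; last first.
  by move=> v va vb; rewrite h // m0 // subrr normr0.
rewrite !m1 ?inE ?eqxx ?orbT //.
have -> : y b = 1 - y a by lra.
have -> : 1 - y a - 2^-1 = - (y a - 2^-1) by lra.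
rewrite normrN -mulr2n -normrMn; congr (`|_|); rewrite mulr2n; lra.
Qed.

(** A cell is the unit ball of [cell_dist] in its affine hull; staying in it under a homothety
    becomes a single inequality. *)
Lemma closed_cellP A y : tree_cell e A ->
  closed_cell R A y <-> affine_in A y /\ cell_dist A y <= 1.
Proof.
move=> /tree_cellP[[a ->]|[a [b [eab ->]]]].
  split=> [[_ h ys]|[/[dup] yA /affine_vertexP h _]].
    by split; [split | rewrite cell_dist_vertex ?ler01].
  by split; [move=> v; rewrite h ler0n | exact: yA.1 | exact: yA.2].
have ab := tree_edge_neq treeE eab.
split=> [[yp h ys]|[yA]].
  have yA : affine_in [set a; b] y by [].
  have [_ ys'] := (affine_edgeP y ab).1 yA.
  split=> //; rewrite cell_dist_edge // ler_norml.
  by have := yp a; have := yp b; lra.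
have [h0 ys'] := (affine_edgeP y ab).1 yA.
rewrite cell_dist_edge // ler_norml => /andP[h1 h2].
split; [|exact: yA.1|exact: yA.2] => v.
have [->|va] := eqVneq v a; first by lra.
by have [->|vb] := eqVneq v b; [lra | rewrite h0].
Qed.

Lemma cell_mid_affine A : tree_cell e A -> affine_in A (cell_mid A).
Proof.
move=> /tree_cellP[[a ->]|[a [b [eab ->]]]].
  by apply/affine_vertexP => v; rewrite /cell_mid inE cards1 divr1.
have ab := tree_edge_neq treeE eab.
apply/(affine_edgeP _ ab); split=> [v /negPf va /negPf vb|].
  by rewrite /cell_mid !inE va vb mul0r.
rewrite /cell_mid !inE !eqxx orbT cards2 ab /=; lra.
Qed.

Lemma cell_scale_affine A l y : tree_cell e A -> affine_in A y ->
  affine_in A (cell_scale A l y).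
Proof.
move=> /cell_mid_affine[m0 ms] [y0 ys]; split=> [v vA|].
  by rewrite /cell_scale m0 // y0 // subrr mul0r addr0.
rewrite big_split /= ms -mulr_suml sumrB ys ms; lra.
Qed.

Lemma cell_dist_scale A l y : cell_dist A (cell_scale A l y) = cell_dist A y * `|l|.
Proof.
rewrite /cell_dist mulr_suml; apply: eq_bigr => v _.
by rewrite /cell_scale addrAC subrr add0r normrM.
Qed.

Lemma cell_scale1 A y : cell_scale A 1 y = y.
Proof. by apply: funext => v; rewrite /cell_scale mulr1 addrC subrK. Qed.

Lemma closed_cell_scale A l y : tree_cell e A -> closed_cell R A y ->
  cell_dist A y * `|l| <= 1 -> closed_cell R A (cell_scale A l y).
Proof.
move=> cA /(closed_cellP _ cA)[yA _] h; apply/(closed_cellP _ cA).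
by split; [exact: cell_scale_affine | rewrite cell_dist_scale].
Qed.

Lemma cell_dist_le1 A y : tree_cell e A -> closed_cell R A y -> cell_dist A y <= 1.
Proof. by move=> cA /(closed_cellP _ cA)[]. Qed.

Lemma closed_cell_vertexP a y : closed_cell R [set a] y <-> forall v, y v = (v == a)%:R.
Proof.
rewrite closed_cellP ?tree_cell1 //; split=> [[/affine_vertexP//]|h].
have yA : affine_in [set a] y by apply/affine_vertexP.
by rewrite cell_dist_vertex ?ler01.
Qed.

Lemma cell_dist_eq1 A y : tree_cell e A -> closed_cell R A y -> cell_dist A y = 1 ->
  exists v, [/\ v \in A, #|A| = 2%N & closed_cell R [set v] y].
Proof.
move=> cA /(closed_cellP _ cA)[+ _].
case/tree_cellP: cA => [[a ->]|[a [b [eab ->]]]] yA.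
  by rewrite cell_dist_vertex // => /eqP; rewrite eq_sym oner_eq0.
have ab := tree_edge_neq treeE eab.
have [h0 ys'] := (affine_edgeP y ab).1 yA.
rewrite cell_dist_edge // => /eqP; rewrite eqr_norml ler01 andbT => /orP[]/eqP h.
- exists a; rewrite !inE eqxx cards2 ab; split=> //; apply/closed_cell_vertexP => v.
  have [->|va] := eqVneq v a; first by rewrite /=; lra.
  by have [->|vb] := eqVneq v b; [rewrite /=; lra | rewrite h0].
- exists b; rewrite !inE eqxx orbT cards2 ab; split=> //; apply/closed_cell_vertexP => v.
  have [->|vb] := eqVneq v b; first by rewrite /=; lra.
  by have [->|va] := eqVneq v a; [rewrite /=; lra | rewrite h0].
Qed.

(** Below distance 1 all barycentric coordinates on [A] are nonzero, so the point lies in the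
    relative interior of [A]. *)
Lemma cell_dist_lt1 A B y : tree_cell e A -> closed_cell R A y -> closed_cell R B y ->
  cell_dist A y < 1 -> A \subset B.
Proof.
move=> cA yA [_ yB _] ylt; apply/subsetP => v vA; apply/negPn/negP => /yB yv.
move: yA => /(closed_cellP _ cA)[+ _]; move: vA ylt.
case/tree_cellP: cA => [[a ->]|[a [b [eab ->]]]].
  by rewrite inE => /eqP va _ /affine_vertexP/(_ v)/eqP; rewrite yv va eqxx eq_sym oner_eq0.
have ab := tree_edge_neq treeE eab.
move=> vA + yA; have [h0 ys'] := (affine_edgeP y ab).1 yA.
rewrite cell_dist_edge // ltr_norml => /andP[h1 h2].
by move: vA; rewrite !inE => /orP[]/eqP va; rewrite va in yv; lra.
Qed.

Lemma closed_cell_convex A y z t : closed_cell R A y -> closed_cell R A z -> 0 <= t <= 1 ->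
  closed_cell R A (fun v => y v + t * (z v - y v)).
Proof.
move=> [yp y0 ys] [zp z0 zs] /andP[t0 t1]; split.
- by move=> v; have := yp v; have := zp v; nra.
- by move=> v vA; rewrite y0 // z0 // subrr mulr0 addr0.
- by rewrite big_split /= -mulr_sumr sumrB ys zs subrr mulr0 addr0.
Qed.

Lemma closed_cell_sub A B y : A \subset B -> closed_cell R A y -> closed_cell R B y.
Proof.
move=> AB [yp y0 ys]; split=> // v vB; apply: y0.
by apply: contraNN vB; exact: (subsetP AB).
Qed.

End CellGeometry.

(** * Collapses of realizations *)

Section RealizationTopology.
Local Open Scope classical_set_scope.
Local Open Scope ring_scope.
Variables (V : finType) (e : rel V) (R : realType) (n : nat).
Hypothesis treeE : tree e.
Local Notation E := (prod_topology (fun _ : 'I_n => prod_topology (fun _ : V => R))).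
Local Notation cell := {ffun 'I_n -> {set V}}.
Local Notation cub := (cubical_complex e n).
Local Notation le := (@face_le V n).
Implicit Types (K : {set cell}) (a b c : cell) (x : E).

Definition cell_set c : set E := [set x | forall i, closed_cell R (c i) (x i)].

Lemma realizationE K : realization R K = [set x | exists2 c, c \in enum K & cell_set c x].
Proof.
by apply/seteqP; split=> x [c cK h]; exists c => //; rewrite ?mem_enum // -mem_enum.
Qed.

Lemma realization_sub K K' : (K \subset K')%SET -> realization R K `<=` realization R K'.
Proof. by move=> /fintype.subsetP KK' x [c /KK' cK' h]; exists c. Qed.

Lemma coord_ctn i v : continuous (fun x : E => x i v).
Proof.
apply: (@comp_continuous E (prod_topology (fun _ : V => R)) R (fun x => x i) (fun y => y v)).
  exact: (@proj_continuous 'I_n (fun=> prod_topology (fun _ : V => R)) i).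
exact: (@proj_continuous V (fun=> R : topologicalType) v).
Qed.

Lemma cell_set_closed c : closed (cell_set c).
Proof.
have ge0 (f : E -> R) : continuous f -> closed [set x | 0 <= f x].
  move=> cf; rewrite (_ : [set x | _] = f @^-1` [set r | 0 <= r]) //.
  by apply: closed_comp; [move=> x _; exact: cf | exact: closed_ge].
have eq0 (f : E -> R) r : continuous f -> closed [set x | f x = r].
  move=> cf; rewrite (_ : [set x | _] = f @^-1` [set r]) //.
  by apply: closed_comp; [move=> x _; exact: cf | exact: closed_set1R].
rewrite (_ : cell_set c = \bigcap_i ((\bigcap_v [set x : E | 0 <= x i v]) `&`
    (\bigcap_(v in [set v | v \notin c i]) [set x : E | x i v = 0]) `&`
    [set x : E | \sum_v x i v = 1])).
  apply: closed_bigI => i _; apply: closedI; [apply: closedI|].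
  - by apply: closed_bigI => v _; apply: ge0; exact: coord_ctn.
  - by apply: closed_bigI => v _; apply: eq0; exact: coord_ctn.
  - by apply: eq0; apply: cts_sum => v; exact: coord_ctn.
apply/seteqP; split=> x h i.
  move=> _; have [h1 h2 h3] := h i; split=> //; split=> v; first by move=> _; exact: h1.
  exact: h2.
by have [[h1 h2] h3] := h i I; split=> // v; exact: h1.
Qed.

Lemma realization_closed K : closed (realization R K).
Proof.
by rewrite realizationE; apply: closed_finite_cover => c _; exact: cell_set_closed.
Qed.

Lemma realization_compact K : compact (realization R K).
Proof.
pose cube : set (prod_topology (fun _ : V => R)) :=
  [set y | forall v, (`[(0 : R), 1]%classic : set R) (y v)].
have cB : compact ([set x | forall i, cube (x i)] : set E).
  apply: (@tychonoff 'I_n (fun=> prod_topology (fun _ : V => R)) (fun=> cube)) => i.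
  apply: (@tychonoff V (fun=> R : topologicalType) (fun=> `[(0 : R), 1]%classic)) => v.
  exact: segment_compact.
apply: (subclosed_compact (@realization_closed K) cB) => x [c _ h] i v /=.
have [h1 h2 h3] := h i; rewrite in_itv /= h1 -h3 (bigD1 v) //= lerDl.
exact: sumr_ge0.
Qed.

Lemma realization_set1 p : minimal_cell le cub p ->
  exists x0, realization R [set p]%SET = [set x0].
Proof.
move=> /minimal_cellP mp.
pose x0 : E := fun i v => (p i == [set v]%SET)%:R.
exists x0; apply/seteqP; split=> x.
  move=> [c]; rewrite inE => /eqP -> h; apply: funext => i; apply: funext => v.
  have [w pw] := mp i; have := h i; rewrite pw => /(closed_cell_vertexP treeE) ->.
  by rewrite /x0 pw (inj_eq (@finset.set1_inj V)) eq_sym.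
move=> ->; exists p; rewrite ?inE // => i; have [w pw] := mp i; rewrite pw.
apply/(closed_cell_vertexP treeE) => v.
by rewrite /x0 pw (inj_eq (@finset.set1_inj V)) eq_sym.
Qed.

(** * Pushing in one free face *)

Section ElementaryCollapse.
Variables (K : {set cell}) (a b : cell).
Hypotheses (dK : down_closed le cub K) (bK : b \in K).
Hypothesis cab : covers le cub a b.
Hypothesis freeab : forall c, c \in K -> le a c -> c = a \/ c = b.
Variables (i0 : 'I_n) (x0 y0 : V).
Hypotheses (exy : e x0 y0) (ai0 : a i0 = [set x0]%SET) (bi0 : b i0 = [set x0; y0]%SET).
Hypothesis abj : forall j, j != i0 -> a j = b j.
Let K' := (K :\ a :\ b)%SET.

Let bC i : tree_cell e (b i).
Proof. by case: cab => _ /cubP. Qed.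

Let nxy : x0 != y0 := tree_edge_neq treeE exy.

(** The distance from the projection centre, where the [x0]-weight is 2, normalised to be 1 on the
    faces that receive the image: the term at [i0] is 1 opposite to [a], the others are 1 on the
    side faces. The bound 1/2 changes nothing on the cube and keeps the divisor positive everywhere,
    which makes the projection continuous on the whole space. *)
Definition collapse_gauge x : R := Num.max 2^-1
  (\big[Num.max/0]_i (if i == i0 then 1 - x i0 x0 / 2 else cell_dist (b i) (x i))).

(* Projection of the cube [b] from a point above its free face [a]. *)
Definition collapse_center i v : R :=
  if i == i0 then 2 * (v == x0)%:R - (v == y0)%:R else cell_mid R (b i) v.

Definition collapse_proj x : E :=
  fun i v => collapse_center i v + (x i v - collapse_center i v) / collapse_gauge x.

Lemma collapse_gauge_gt0 x : 0 < collapse_gauge x.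
Proof. by rewrite lt_max invr_gt0 ltr0n. Qed.

Lemma cell_dist_ctn A i : continuous (fun x : E => cell_dist A (x i)).
Proof.
apply: cts_sum => v; apply: cts_norm; apply: cts_sub; first exact: coord_ctn.
exact: cts_cst.
Qed.

Lemma collapse_proj_continuous : continuous collapse_proj.
Proof.
apply: prod_topology_continuous => i; apply: prod_topology_continuous => v.
apply: cts_add; first exact: cts_cst.
apply: cts_div; first by move=> x; rewrite gt_eqF ?collapse_gauge_gt0.
  by apply: cts_sub; [exact: coord_ctn | exact: cts_cst].
apply: cts_max; first exact: cts_cst.
apply: cts_bigmax => j; case: (j == i0); last exact: cell_dist_ctn.
apply: cts_sub; first exact: cts_cst.
by apply: cts_mul; [exact: coord_ctn | exact: cts_cst].
Qed.

Let bcoord x : cell_set b x -> [/\ 0 <= x i0 x0, x i0 x0 + x i0 y0 = 1, 0 <= x i0 y0 &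
  forall v, v != x0 -> v != y0 -> x i0 v = 0].
Proof.
move=> /(_ i0); rewrite bi0 => -[h1 h2 h3].
have [h4 h5] := (affine_edgeP (x i0) nxy).1 (conj h2 h3).
by split.
Qed.

Lemma collapse_gauge_le1 x : cell_set b x -> collapse_gauge x <= 1.
Proof.
move=> xb; rewrite ge_max; apply/andP; split; first by lra.
apply: bigmax_le => // i _; case: eqP => [_|_]; last exact: (cell_dist_le1 treeE (bC i) (xb i)).
by have [h _ _ _] := bcoord xb; lra.
Qed.

Lemma collapse_gauge_ge x : 1 - x i0 x0 / 2 <= collapse_gauge x.
Proof.
rewrite le_max; apply/orP; right.
by apply: (bigmax_sup i0) => //; rewrite eqxx.
Qed.

Lemma collapse_gauge_dist x i : i != i0 -> cell_dist (b i) (x i) <= collapse_gauge x.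
Proof.
move=> ii0; rewrite le_max; apply/orP; right.
by apply: (bigmax_sup i) => //; rewrite (negPf ii0).
Qed.

(** The term that attains the maximum decides on which face the projection lands. On the cube the
    term at [i0] is at least 1/2, so the lower bound needs no case. *)
Lemma collapse_gauge_attained x : cell_set b x -> collapse_gauge x = 1 - x i0 x0 / 2 \/
  exists2 i, i != i0 & collapse_gauge x = cell_dist (b i) (x i).
Proof.
move=> xb; have [h0 h1 h2 _] := bcoord xb.
have [E|nE] := eqVneq (collapse_gauge x) (1 - x i0 x0 / 2); [by left|right].
apply: contrapT => nex.
have hge := collapse_gauge_ge x.
have hlt : 1 - x i0 x0 / 2 < collapse_gauge x by rewrite lt_neqAle eq_sym nE hge.
have : collapse_gauge x < collapse_gauge x; last by rewrite ltxx.
rewrite {1}/collapse_gauge gt_max; apply/andP; split; first by lra.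
apply: bigmax_lt; first exact: collapse_gauge_gt0.
move=> i _; have [_//|ii0] := eqVneq i i0.
rewrite lt_neqAle collapse_gauge_dist // andbT; apply/eqP => h.
by apply: nex; exists i.
Qed.

Lemma collapse_proj_scale x i : i != i0 ->
  collapse_proj x i = cell_scale (b i) (collapse_gauge x)^-1 (x i).
Proof.
by move=> ii0; apply: funext => v; rewrite /collapse_proj /collapse_center (negPf ii0).
Qed.

Lemma collapse_proj_i0 x : cell_set b x -> [/\
  collapse_proj x i0 x0 = 2 - (2 - x i0 x0) / collapse_gauge x,
  collapse_proj x i0 y0 = (2 - x i0 x0) / collapse_gauge x - 1 &
  forall v, v != x0 -> v != y0 -> collapse_proj x i0 v = 0].
Proof.
move=> /bcoord[_ h1 _ h2]; rewrite /collapse_proj /collapse_center eqxx; split.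
- rewrite eqxx (negPf nxy) /= subr0 mulr1; ring.
- rewrite eqxx eq_sym (negPf nxy) /= mulr0 sub0r (_ : x i0 y0 = 1 - x i0 x0); last by lra.
  ring.
- by move=> v vx vy; rewrite h2 // (negPf vx) (negPf vy) mulr0 !subrr mul0r addr0.
Qed.

Lemma collapse_proj_cell x : cell_set b x -> cell_set b (collapse_proj x).
Proof.
move=> xb i; have M0 := collapse_gauge_gt0 x.
have [->|ii0] := eqVneq i i0; last first.
  rewrite collapse_proj_scale //; apply: (closed_cell_scale treeE) => //.
  rewrite ger0_norm ?invr_ge0 ?(ltW M0) // ler_pdivrMr // mul1r.
  exact: collapse_gauge_dist.
have [p1 p2 p3] := collapse_proj_i0 xb; have [c1 c2 c3 c4] := bcoord xb.
have hle : (2 - x i0 x0) / collapse_gauge x <= 2.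
  by rewrite ler_pdivrMr //; have := collapse_gauge_ge x; lra.
have hge : 1 <= (2 - x i0 x0) / collapse_gauge x.
  by rewrite ler_pdivlMr //; have := collapse_gauge_le1 xb; lra.
have : affine_in [set x0; y0]%SET (collapse_proj x i0).
  by apply/(affine_edgeP _ nxy); split=> //; rewrite p1 p2; lra.
rewrite bi0 => -[h1 h2]; split=> // v.
have [->|vx] := eqVneq v x0; first by rewrite p1; lra.
by have [->|vy] := eqVneq v y0; [rewrite p2; lra | rewrite p3].
Qed.

Let face_in i A : tree_cell e A -> A \subset b i -> A != b i -> A != a i ->
  cell_upd b i A \in K'.
Proof.
move=> cA sA nbA naA; rewrite !inE; apply/and3P; split.
- by apply: contraNneq nbA => /ffunP/(_ i); rewrite ffunE eqxx => ->.
- by apply: contraNneq naA => /ffunP/(_ i); rewrite ffunE eqxx => ->.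
- apply: dK.2 bK _; first by apply: cub_upd => //; case: cab.
  by apply/face_leP => j; rewrite ffunE; case: eqP => [->|].
Qed.

Let face_set i A x : cell_set b x -> closed_cell R A (x i) -> cell_set (cell_upd b i A) x.
Proof. by move=> xb xA j; rewrite ffunE; case: eqP => [->|_] //; exact: xb. Qed.

(** The image has an entry at an end of its edge: [y0] at [i0], or some end elsewhere. The
    corresponding face of [b] is neither [a] nor [b]. *)
Lemma collapse_proj_in x : cell_set b x -> realization R K' (collapse_proj x).
Proof.
move=> xb; have pb := collapse_proj_cell xb; have M0 := collapse_gauge_gt0 x.
have [E|[i ii0 E]] := collapse_gauge_attained xb.
  have [p1 p2 p3] := collapse_proj_i0 xb.
  have E2 : (2 - x i0 x0) / collapse_gauge x = 2.
    have -> : 2 - x i0 x0 = 2 * collapse_gauge x by rewrite E; lra.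
    by rewrite mulfK // gt_eqF.
  exists (cell_upd b i0 [set y0]%SET).
    apply: face_in; rewrite ?bi0 ?ai0 ?tree_cell1 //.
    - by rewrite finset.sub1set !inE eqxx orbT.
    - by apply/eqP => /finset.setP/(_ x0); rewrite !inE eqxx (negPf nxy).
    - by apply: contraNneq nxy => /finset.set1_inj ->.
  apply: face_set => //; apply/(closed_cell_vertexP treeE) => v.
  have [->|vy] := eqVneq v y0; first by rewrite p2 E2 /=; lra.
  by have [->|vx] := eqVneq v x0; [rewrite p1 E2 /=; lra | rewrite p3].
have [] := @cell_dist_eq1 _ _ _ treeE _ _ (bC i) (pb i).
  rewrite collapse_proj_scale // cell_dist_scale -E ger0_norm ?invr_ge0 ?(ltW M0) //.
  by rewrite divff // gt_eqF.
move=> v [vb b2 pv]; exists (cell_upd b i [set v]%SET); last exact: face_set.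
have nv : [set v]%SET != b i by apply/eqP => h; move: b2; rewrite -h cards1.
apply: face_in; rewrite ?abj ?tree_cell1 //.
by rewrite finset.sub1set.
Qed.

(** With gauge below 1, the point has positive [x0]-weight and is interior in the other coordinates.
    Any cell containing it is then above [a], hence is [a] or [b] by freeness, and these are not in
    [K']. *)
Lemma collapse_proj_fix x : cell_set b x -> realization R K' x -> collapse_proj x = x.
Proof.
move=> xb [c cK' xc].
suff M1 : collapse_gauge x = 1.
  by apply: funext => i; apply: funext => v; rewrite /collapse_proj M1 divr1 addrC subrK.
apply/eqP; rewrite eq_le collapse_gauge_le1 // leNgt; apply/negP => Mlt.
have [c1 c2 c3 c4] := bcoord xb.
move: cK'; rewrite !inE => /and3P[/eqP cb /eqP ca cK].
have [] // := freeab cK; apply/face_leP => i.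
have [->|ii0] := eqVneq i i0; last first.
  rewrite abj //; apply: (cell_dist_lt1 treeE (bC i) (xb i) (xc i)).
  by apply: le_lt_trans Mlt; exact: collapse_gauge_dist.
rewrite ai0 finset.sub1set; apply/negPn/negP => /(let: And3 _ h _ := xc i0 in h) x00.
by have := collapse_gauge_ge x; rewrite x00; lra.
Qed.

(** The projection on [b] and the identity on the rest agree on the overlap and form a retraction.
    Straight segments join it to the identity, inside [b] by convexity, and [contraction_retract]
    applies. *)
Lemma collapse_step_contraction (H : E * R -> E) p : contraction (realization R K') H p ->
  exists H' : E * R -> E, contraction (realization R K) H' p.
Proof.
move=> cH.
have KE : realization R K = realization R K' `|` cell_set b.
  apply/seteqP; split=> x.
    move=> [c cK xc]; have [cb|cb] := eqVneq c b; first by right; rewrite -cb.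
    have [ca|ca] := eqVneq c a.
      by right=> i; apply: closed_cell_sub (xc i); rewrite ca; case: cab => _ _ _ /face_leP.
    by left; exists c => //; rewrite !inE cb ca.
  move=> [|xb]; last by exists b.
  by apply: realization_sub; apply/fintype.subsetP => c; rewrite !inE => /and3P[].
pose f x := if pselect (realization R K' x) then x else collapse_proj x.
have fb x : cell_set b x -> f x = collapse_proj x.
  by move=> xb; rewrite /f; case: pselect => // xK'; rewrite collapse_proj_fix.
have fK x : realization R K' x -> f x = x by move=> xK'; rewrite /f; case: pselect.
have cf : {within realization R K, continuous f}.
  rewrite KE; apply: withinU_continuous; [exact: realization_closed|exact: cell_set_closed| |].
    apply: (@within_eq _ _ _ id) => [x /fK ->//|]; apply: continuous_subspaceT.
    by move=> x; exact: cvg_id.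
  apply: (@within_eq _ _ _ collapse_proj) => [x /fb ->//|].
  exact/continuous_subspaceT/collapse_proj_continuous.
pose D (z : E * R) : E := fun i v => z.1 i v + z.2 * (f z.1 i v - z.1 i v).
apply: (@contraction_retract R E (realization R K') _ H p D) => //.
- exact: realization_closed.
- by rewrite KE => x; left.
- apply: (@prod_topology_continuous (subspace (realization R K `*` `[(0:R), 1]))) => i.
  apply: (@prod_topology_continuous (subspace (realization R K `*` `[(0:R), 1]))) => v.
  have cfst : {within realization R K `*` `[(0:R), 1], continuous (fun z : E * R => z.1 i v)}.
    apply: continuous_subspaceT.
    apply: (@comp_continuous (E * R)%type E R fst (fun x => x i v)); first exact: fst_continuous.
    exact: coord_ctn.
  have csnd : {within realization R K `*` `[(0:R), 1], continuous (fun z : E * R => z.2)}.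
    by apply: continuous_subspaceT; exact: snd_continuous.
  apply: cts_add => //; apply: cts_mul => //.
  apply: cts_sub => //.
  apply: (@comp_continuous _ E R
    (fun z : subspace (realization R K `*` `[(0:R), 1]) => f z.1) (fun x => x i v)).
    apply: (within_comp cf); first exact/continuous_subspaceT/fst_continuous.
    by move=> z [].
  exact: coord_ctn.
- move=> x t; rewrite KE => -[xK'|xb] tI.
    left; rewrite (_ : D (x, t) = x) //; apply: funext => i; apply: funext => v.
    by rewrite /D /= fK // subrr mulr0 addr0.
  right=> i; apply: closed_cell_convex => //=; rewrite fb //.
  exact: collapse_proj_cell.
- by move=> x _; apply: funext => i; apply: funext => v; rewrite /D /= mul0r addr0.
- move=> x Kx; rewrite (_ : D (x, 1) = f x); last first.
    by apply: funext => i; apply: funext => v; rewrite /D /= mul1r addrC subrK.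
  by move: Kx; rewrite KE => -[xK'|xb]; [rewrite fK | rewrite fb //; exact: collapse_proj_in].
Qed.

End ElementaryCollapse.

Lemma collapse_contraction K p : down_closed le cub K -> minimal_cell le cub p ->
  collapse le K [set p]%SET -> exists (H : E * R -> E) q, contraction (realization R K) H q.
Proof.
move=> dK mp; move: K dK; apply: (collapse_ind_closed (@face_le_trans V n)).
  move=> K a b dK aK bK cab h [H [q cH]].
  have [i0 [x0 [y0 [exy ai0 bi0 abj]]]] := covers_shape treeE cab.
  have [H' cH'] := collapse_step_contraction dK bK cab h exy ai0 bi0 abj cH.
  by exists H', q.
have [x0 ->] := realization_set1 mp.
exists fst, x0; split=> //; first exact/continuous_subspaceT/fst_continuous.
Qed.

End RealizationTopology.

(** * Quotients of compact spaces *)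

Section Quotients.
Local Open Scope classical_set_scope.
Local Open Scope ring_scope.

Lemma cluster_image (X Y : topologicalType) (f : X -> Y) p q : continuous f ->
  cluster (nbhs p) q -> cluster (nbhs (f p)) (f q).
Proof.
move=> cf pq U W /cf fU /cf fW.
by have [z [Uz Wz]] := pq _ _ fU fW; exists (f z).
Qed.

Lemma pair_hausdorff (X Y : topologicalType) : hausdorff_space X -> hausdorff_space Y ->
  hausdorff_space (X * Y)%type.
Proof.
move=> hX hY [a b] [a' b'] h; congr pair.
  exact/hX/(cluster_image (@fst_continuous X Y) h).
exact/hY/(cluster_image (@snd_continuous X Y) h).
Qed.

Lemma set_val_continuous (X : topologicalType) (A : set X) : continuous (set_val : A -> X).
Proof. exact: initial_continuous. Qed.

Lemma set_type_hausdorff (X : topologicalType) (A : set X) : hausdorff_space X ->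
  hausdorff_space A.
Proof.
move=> hX p q h; apply: val_inj; exact/hX/(cluster_image (@set_val_continuous X A) h).
Qed.

Lemma set_type_continuous (X Y : topologicalType) (A : set Y) (f : X -> A) :
  continuous (fun x => set_val (f x)) -> continuous f.
Proof. exact: continuous_comp_initial. Qed.

Lemma set_type_compact (X : topologicalType) (A : set X) : compact A -> compact [set: A].
Proof.
move=> cA F FF _.
have [x [Ax cx]] : A `&` cluster (set_val @ F) !=set0.
  apply: cA; apply: (@filterS _ F _ setT); last exact: filterT.
  by move=> z _; exact: set_valP.
exists (SigSub (mem_set Ax)); split=> // U W FU [B [[Q oQ <-] Qx sB]].
have [_ [[u Uu <-] Qu]] : ((set_val : A -> X) @` U) `&` Q !=set0.
  apply: cx; last exact: open_nbhs_nbhs.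
  by apply: (@filterS _ F _ U) => // u Uu; exists u.
by exists u; split=> //; exact: sB.
Qed.

Lemma quotient_descent (X Y Z : topologicalType) (q : X -> Y) (h : X -> Z) :
  compact [set: X] -> hausdorff_space Y -> continuous q -> (forall y, exists x, q x = y) ->
  continuous h -> (forall x x', q x = q x' -> h x = h x') ->
  exists h', continuous h' /\ forall x, h' (q x) = h x.
Proof.
move=> cX hY cq sq ch hq; have /choice[s sP] := sq.
have hE x : h (s (q x)) = h x by apply: hq; rewrite sP.
exists (fun y => h (s y)); split=> //; apply/continuous_closedP => C cC.
rewrite (_ : _ @^-1` C = q @` (h @^-1` C)); last first.
  apply/seteqP; split=> y /=; first by move=> Cy; exists (s y).
  by move=> [x Cx <-]; rewrite hE.
apply: compact_closed => //; apply: continuous_compact.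
  exact: continuous_subspaceT.
by apply: subclosed_compact cX _ => //; move/continuous_closedP: ch; exact.
Qed.

Variable R : realType.
Local Notation I := (@unit_interval R).

Lemma unit_interval0 : @unit_interval R 0.
Proof. by rewrite /unit_interval /= in_itv /= lexx ler01. Qed.

(** [G] runs backwards, from a map that is constant on [A] to the identity. Its time 0 descends to
    the homotopy inverse of [phi]. The composite of [phi] with [G] descends to a homotopy on [W],
    since the product of [phi] with the interval is again a quotient map by compactness. *)
Lemma collapse_equivalence (X W : topologicalType) (A : set X) (phi : X -> W)
    (G : X * I -> X) :
  compact [set: X] -> hausdorff_space W -> continuous phi -> (forall w, exists x, phi x = w) ->
  (forall x x', phi x = phi x' -> x = x' \/ A x /\ A x') ->
  (forall x x', A x -> A x' -> phi x = phi x') ->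
  continuous G -> (forall x t, A x -> A (G (x, t))) ->
  (forall x x' t, set_val t = 0 -> A x -> A x' -> G (x, t) = G (x', t)) ->
  (forall x t, set_val t = 1 -> G (x, t) = x) ->
  homotopy_equivalent R X W.
Proof.
move=> cX hW cphi sphi iphi Aphi cG GA G0 G1.
pose t0 : I := SigSub (mem_set unit_interval0).
have [|x x' /iphi[->//|[Ax Ax']]|g [cg gE]] :=
    @quotient_descent X W X phi (fun x => G (x, t0)) cX hW cphi sphi.
- apply: comp_continuous cG; apply: pair_continuous; first by move=> x; exact: cvg_id.
  by move=> x; exact: cvg_cst.
- exact: G0.
pose q (z : X * I) : W * I := (phi z.1, z.2).
have cI : compact [set: I] by apply: set_type_compact; exact: segment_compact.
have [| | |[w t]| |[x t] [x' t'] [E <-]|L [cL LE]] :=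
    @quotient_descent (X * I)%type (W * I)%type W q (fun z => phi (G z)).
- by rewrite -setXTT; exact: compact_setX.
- by apply: pair_hausdorff => //; apply: set_type_hausdorff; exact: Rhausdorff.
- apply: pair_continuous; last exact: snd_continuous.
  by apply: comp_continuous cphi; exact: fst_continuous.
- by have [x <-] := sphi w; exists (x, t).
- exact: comp_continuous cphi.
- by have [->//|[Ax Ax']] := iphi _ _ E; apply: Aphi; exact: GA.
exists phi, g; split=> //.
- exists G; split=> // x t t00 /=; rewrite gE; congr (G (x, _)); exact: val_inj.
- exists L; split=> // w t h; have [x <-] := sphi w; have := LE (x, t); rewrite /q /= => ->.
    rewrite gE; congr (phi (G (x, _))); exact: val_inj.
  by rewrite G1.
Qed.

End Quotients.

(** * From the cube to the sphere *)

Section CubeToSphere.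
Local Open Scope ring_scope.
Variables (R : realType) (d : nat).
Implicit Types (u z : 'I_d -> R).

Definition sup_abs u : R := \big[Num.max/0]_l `|u l|.
Definition cube_height u : R := 1 - sup_abs u.
Definition cube_sq u : R := \sum_l u l ^+ 2.
Definition cube_den u : R := cube_sq u + cube_height u ^+ 2.

(* Inverse stereographic projection of [u / cube_height u] with the
   denominators cleared, so that it makes sense on the boundary of the cube,
   which goes to the base point. *)
Definition cube_sphere u : 'rV[R]_d.+1 :=
  \row_j (if unlift ord0 j is Some l then 2 * u l * cube_height u / cube_den u
          else (cube_sq u - cube_height u ^+ 2) / cube_den u).

Lemma le_sup_abs u l : `|u l| <= sup_abs u.
Proof. exact: (le_bigmax 0 (fun l => `|u l|)). Qed.

Lemma sup_abs_ge0 u : 0 <= sup_abs u.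
Proof. exact: bigmax_ge_id. Qed.

Lemma sup_abs_le u r : 0 <= r -> (forall l, `|u l| <= r) -> sup_abs u <= r.
Proof. by move=> r0 h; apply: bigmax_le. Qed.

Lemma sup_absZ k u : 0 <= k -> sup_abs (fun l => k * u l) = k * sup_abs u.
Proof.
move=> k0; rewrite /sup_abs (big_morph (fun r => k * r) (fun x y => maxr_pMr x y k0) (mulr0 k)).
by apply: eq_bigr => l _; rewrite normrM ger0_norm.
Qed.

Lemma cube_sq_ge0 u : 0 <= cube_sq u.
Proof. by apply: sumr_ge0 => l _; exact: sqr_ge0. Qed.

(** If the sum of squares vanishes, then [u] is the centre, where the height is 1. *)
Lemma cube_den_gt0 u : 0 < cube_den u.
Proof.
rewrite lt_neqAle addr_ge0 ?cube_sq_ge0 ?sqr_ge0 // andbT eq_sym.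
apply/negP; rewrite paddr_eq0 ?cube_sq_ge0 ?sqr_ge0 // => /andP[+ h].
rewrite psumr_eq0 => [/allP u0|l _]; last exact: sqr_ge0.
move: h; rewrite sqrf_eq0 subr_eq0 => /eqP h.
have : sup_abs u <= 0.
  apply: sup_abs_le => // l; have := u0 l (mem_index_enum _).
  by rewrite sqrf_eq0 => /eqP ->; rewrite normr0.
by rewrite -h ler10.
Qed.

Lemma cube_sphere0 u : cube_sphere u 0 0 = (cube_sq u - cube_height u ^+ 2) / cube_den u.
Proof. by rewrite mxE unlift_none. Qed.

Lemma cube_sphereS u l : cube_sphere u 0 (lift ord0 l) = 2 * u l * cube_height u / cube_den u.
Proof. by rewrite mxE liftK. Qed.

Lemma cube_sphere_in u : euclidean_sphere (cube_sphere u).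
Proof.
rewrite /euclidean_sphere /= big_ord_recl cube_sphere0.
under eq_bigr => l _ do rewrite cube_sphereS.
have -> : \sum_(l < d) (2 * u l * cube_height u / cube_den u) ^+ 2 =
    4 * cube_height u ^+ 2 * cube_sq u / cube_den u ^+ 2.
  rewrite /cube_sq mulr_sumr mulr_suml; apply: eq_bigr => l _.
  by rewrite !exprMn exprVn; ring.
rewrite exprMn exprVn -mulrDl (_ : _ + _ = cube_den u ^+ 2); last by rewrite /cube_den; ring.
by rewrite divff // gt_eqF // exprn_gt0 // cube_den_gt0.
Qed.

(** The zeroth coordinate falls short of 1 by twice the squared height over [cube_den u]. *)
Lemma cube_sphere_base u : (cube_sphere u == delta_mx 0 0) = (cube_height u == 0).
Proof.
have D0 := lt0r_neq0 (cube_den_gt0 u); apply/eqP/eqP => [/matrixP/(_ 0 0)|h].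
  rewrite cube_sphere0 mxE !eqxx /= => /(congr1 (fun r => r * cube_den u)).
  rewrite divfK // mul1r /cube_den => h.
  by apply/eqP; rewrite -sqrf_eq0; apply/eqP; lra.
apply/rowP => j; rewrite !mxE; case: unliftP => [l ->|->] /=.
  by rewrite h mulr0 mul0r.
have DE : cube_den u = cube_sq u by rewrite /cube_den h expr0n /= addr0.
by rewrite h expr0n /= subr0 -DE divff.
Qed.

Lemma sphere_baseP (q : 'rV[R]_d.+1) : euclidean_sphere q -> q 0 0 = 1 -> q = delta_mx 0 0.
Proof.
rewrite /euclidean_sphere /= big_ord_recl => + q0; rewrite [q _ ord0]q0 expr1n.
move=> /eqP; rewrite -subr_eq0 addrAC subrr add0r psumr_eq0 => [/allP h|l _]; last exact: sqr_ge0.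
apply/rowP => j; rewrite !mxE; case: (unliftP ord0 j) => [l ->|->] //=.
by have := h l (mem_index_enum _); rewrite sqrf_eq0 => /eqP ->.
Qed.

(** The image determines the stereographic coordinates [u l / cube_height u], and these determine
    the height. *)
Lemma cube_sphere_inj u u' : 0 < cube_height u -> 0 <= cube_height u' ->
  cube_sphere u = cube_sphere u' -> u =1 u'.
Proof.
move=> P0 P'0 E; have D0 := cube_den_gt0 u; have D'0 := cube_den_gt0 u'.
have E0 : cube_height u ^+ 2 / cube_den u = cube_height u' ^+ 2 / cube_den u'.
  have := congr1 (fun q : 'rV_d.+1 => q 0 0) E; rewrite /= !cube_sphere0.
  have key v : (cube_sq v - cube_height v ^+ 2) / cube_den v =
      1 - 2 * (cube_height v ^+ 2 / cube_den v).
    have -> : cube_sq v = cube_den v - cube_height v ^+ 2 by rewrite /cube_den addrK.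
    by field; rewrite gt_eqF ?cube_den_gt0.
  by rewrite !key; lra.
have P'gt : 0 < cube_height u'.
  rewrite lt_neqAle P'0 andbT; apply/eqP => h; move: E0; rewrite -h expr0n /= mul0r => /eqP.
  by rewrite mulf_eq0 invr_eq0 expf_eq0 /= !gt_eqF.
have El l : u l / cube_height u = u' l / cube_height u'.
  have := congr1 (fun q : 'rV_d.+1 => q 0 (lift ord0 l)) E; rewrite /= !cube_sphereS => h.
  have key v : 0 < cube_height v -> v l / cube_height v =
      (2 * v l * cube_height v / cube_den v) / (2 * (cube_height v ^+ 2 / cube_den v)).
    move=> Pv; have Dv := cube_den_gt0 v.
    by field; rewrite !gt_eqF.
  by rewrite (key u) // (key u') // h E0.
(* With equal ratios a smaller height means smaller coordinates, hence a smaller sup norm, hence a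
   height that is not smaller. *)
have mono v v' : 0 < cube_height v -> 0 < cube_height v' ->
    (forall l, v l / cube_height v = v' l / cube_height v') ->
    cube_height v <= cube_height v' -> cube_height v' <= cube_height v.
  move=> Pv Pv' h hle; rewrite lerD2l lerN2; apply: sup_abs_le; first exact: sup_abs_ge0.
  move=> l; apply: le_trans (le_sup_abs v' l).
  have -> : v l = v' l / cube_height v' * cube_height v by rewrite -h divfK // gt_eqF.
  rewrite mulrAC normrM normfV (ger0_norm (ltW Pv')) ler_pdivrMr // normrM ler_wpM2l //.
  by rewrite ger0_norm // ltW.
have PP : cube_height u = cube_height u'.
  apply/eqP; rewrite eq_le; have /orP[h|h] := le_total (cube_height u) (cube_height u').
    by rewrite h (mono _ _ P0 P'gt El h).
  by rewrite h (mono _ _ P'gt P0 (fun l => esym (El l)) h).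
move=> l; have := El l; rewrite -PP => /(congr1 (fun r => r * cube_height u)).
by rewrite !divfK // gt_eqF.
Qed.

Lemma cube_sphere_surj (q : 'rV[R]_d.+1) : euclidean_sphere q -> q 0 0 != 1 ->
  exists u, (forall l, `|u l| <= 1) /\ cube_sphere u = q.
Proof.
move=> sq q1; have sE : q 0 0 ^+ 2 + \sum_(l < d) q 0 (lift ord0 l) ^+ 2 = 1.
  by rewrite -sq big_ord_recl.
have q0lt : q 0 0 < 1.
  rewrite lt_neqAle q1 /=; have : q 0 0 ^+ 2 <= 1.
    by rewrite -sE lerDl; apply: sumr_ge0 => l _; exact: sqr_ge0.
  by rewrite expr2 => h; nra.
have k0 : 0 < 1 - q 0 0 by lra.
(* [z] is the stereographic projection of [q]; division by 1 plus its sup norm gives the point [u]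
   of the open cube whose quotient by its height is [z]. *)
pose z l := q 0 (lift ord0 l) / (1 - q 0 0).
have Z0 := sup_abs_ge0 z.
pose P := (1 + sup_abs z)^-1.
have P0 : 0 < P by rewrite invr_gt0; lra.
pose u l := P * z l.
have uP : cube_height u = P.
  by rewrite /cube_height sup_absZ ?ltW // /P; field; rewrite gt_eqF //; lra.
have uN : cube_sq u = P ^+ 2 * ((1 + q 0 0) / (1 - q 0 0)).
  have -> : cube_sq u = P ^+ 2 * ((\sum_(l < d) q 0 (lift ord0 l) ^+ 2) / (1 - q 0 0) ^+ 2).
    rewrite mulr_suml mulr_sumr; apply: eq_bigr => l _.
    by rewrite /u /z; field; rewrite gt_eqF.
  have -> : \sum_(l < d) q 0 (lift ord0 l) ^+ 2 = 1 - q 0 0 ^+ 2 by rewrite -sE; ring.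
  by field; rewrite gt_eqF.
have uD : cube_den u = P ^+ 2 * (2 / (1 - q 0 0)).
  by rewrite /cube_den uN uP; field; rewrite gt_eqF.
exists u; split.
  move=> l; apply: le_trans (le_sup_abs u l) _.
  by have := uP; rewrite /cube_height; lra.
apply/rowP => j; case: (unliftP ord0 j) => [l ->|->].
  by rewrite cube_sphereS uP uD /u /z; field; rewrite !gt_eqF.
by rewrite [LHS]cube_sphere0 uP uD uN; field; rewrite !gt_eqF.
Qed.

Lemma cube_sphere_continuous (T : topologicalType) (f : 'I_d -> T -> R) :
  (forall l, continuous (f l)) -> continuous (fun x => cube_sphere (fun l => f l x)).
Proof.
move=> cf.
have cP : continuous (fun x => cube_height (fun l => f l x)).
  apply: cts_sub; first exact: cts_cst.
  by apply: cts_bigmax => l; exact: cts_norm.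
have cN : continuous (fun x => cube_sq (fun l => f l x)).
  by apply: cts_sum => l; exact: cts_mul.
have cD : continuous (fun x => cube_den (fun l => f l x)) by apply: cts_add => //; exact: cts_mul.
have D0 x : cube_den (fun l => f l x) != 0 by rewrite gt_eqF ?cube_den_gt0.
apply: matrix_continuous => i j; case: (unliftP ord0 j) => [l ->|->].
  under eq_fun do rewrite mxE liftK.
  apply: cts_div => //; apply: cts_mul => //; apply: cts_mul => //; exact: cts_cst.
under eq_fun do rewrite mxE unlift_none.
by apply: cts_div => //; apply: cts_sub => //; exact: cts_mul.
Qed.

End CubeToSphere.

(** * Collapsing the contractible subcomplex *)

(** In the product of the spaces, a lifted point has the base point in every coordinate but its own;
    the coordinates [i] and [j] are compared. *)
Lemma wedge_lift_eq (k : nat) (X : topologicalType) (p0 : X) (i j : 'I_k) (x y : X) :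
  @wedge_lift 'I_k (fun=> X) (fun=> p0) i x = @wedge_lift 'I_k (fun=> X) (fun=> p0) j y ->
  i = j /\ x = y \/ x = p0 /\ y = p0.
Proof.
move=> /(congr1 (@wedge_prod _ (fun=> X) (fun=> p0))).
rewrite /wedge_prod !wedge_lift_funE; try exact: wedge_prod_pointE.
move=> E; have Ei := congr1 (fun f => f i) E; have Ej := congr1 (fun f => f j) E.
move: Ei Ej; rewrite /= !dfwithin; have [<-|ij] := eqVneq i j.
  by rewrite dfwithin => -> _; left.
by rewrite !dfwithout // 1?eq_sym // => -> <-; right.
Qed.

Section Assembly.
Local Open Scope classical_set_scope.
Local Open Scope ring_scope.
Variables (V : finType) (e : rel V) (R : realType) (n d : nat).
Hypothesis treeE : tree e.
Local Notation E := (prod_topology (fun _ : 'I_n => prod_topology (fun _ : V => R))).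
Local Notation cell := {ffun 'I_n -> {set V}}.
Local Notation cub := (cubical_complex e n).
Local Notation le := (@face_le V n).
Variables (K A : {set cell}).
Hypotheses (dK : down_closed le cub K) (dA : down_closed le cub A) (AK : (A \subset K)%SET).
Local Notation crit := (K :\: A)%SET.
Hypothesis crit_dim : forall c, c \in crit -> cell_dim c = d.
Local Notation X := (realization R K).
Local Notation XA := (realization R A).
Implicit Types (c : cell) (x : E) (j : 'I_#|crit|).

Lemma face_dim c c' : c' \in cub -> c \in cub -> le c' c -> c' != c ->
  (cell_dim c' < cell_dim c)%N.
Proof.
move=> /cubP c'C /cubP cC /face_leP lc nc.
have /existsP[i nci] : [exists i, c' i != c i].
  rewrite -negb_forall; apply: contraNN nc => /forallP h.
  by apply/eqP/ffunP => i; exact/eqP.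
have [x [y [exy c'E cE]]] := tree_cell_proper treeE (c'C i) (cC i) (lc i) nci.
apply: proper_card; apply/properP; split.
  apply/fintype.subsetP => l; rewrite !inE => /eqP h.
  have := subset_leq_card (lc l); rewrite h.
  by have [->|->//] := tree_cell_card treeE (cC l).
exists i; rewrite inE ?cE ?c'E ?cards1 //.
by rewrite finset.cards2 (tree_edge_neq treeE exy).
Qed.

Lemma crit_cub c : c \in crit -> c \in cub.
Proof. by rewrite inE => /andP[_ /(fintype.subsetP dK.1)]. Qed.

Lemma crit_cell c i : c \in crit -> tree_cell e (c i).
Proof. by move=> /crit_cub /cubP. Qed.

(** A proper face has smaller dimension, while all critical cells have dimension [d]. *)
Lemma crit_face c c' : c \in crit -> c' \in cub -> le c' c -> c' != c -> c' \in A.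
Proof.
move=> cc c'C lc nc; apply/negPn/negP => c'A.
have c'K : c' \in K by apply: dK.2 c'C _ lc; move: cc; rewrite inE => /andP[].
have := face_dim c'C (crit_cub cc) lc nc; rewrite !crit_dim ?ltnn // inE c'A.
by [].
Qed.

(** The norm whose unit ball is the cube [c], centred at its barycentre: on the cube, the value 1
    marks the boundary. *)
Definition cell_rho c x : R := \big[Num.max/0]_i cell_dist (c i) (x i).

Lemma cell_rho_ge0 c x : 0 <= cell_rho c x.
Proof. exact: bigmax_ge_id. Qed.

Lemma le_cell_rho c x i : cell_dist (c i) (x i) <= cell_rho c x.
Proof. exact: (le_bigmax 0 (fun i => cell_dist (c i) (x i))). Qed.

Lemma cell_rho_le1 c x : c \in crit -> cell_set c x -> cell_rho c x <= 1.
Proof.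
move=> cc xc; apply: bigmax_le => // i _; exact: (cell_dist_le1 treeE (crit_cell i cc) (xc i)).
Qed.

Lemma cell_rho_attained c x : 0 < cell_rho c x ->
  exists i, cell_dist (c i) (x i) = cell_rho c x.
Proof.
move=> r0; apply: contrapT => nex.
have : cell_rho c x < cell_rho c x; last by rewrite ltxx.
apply: bigmax_lt => // i _; rewrite lt_neqAle le_cell_rho andbT.
by apply/eqP => h; apply: nex; exists i.
Qed.

Lemma cell_rho_eq1 c x : c \in crit -> cell_set c x -> cell_rho c x = 1 -> XA x.
Proof.
move=> cc xc r1; have [|i] := @cell_rho_attained c x; first by rewrite r1.
rewrite r1 => /(cell_dist_eq1 treeE (crit_cell i cc) (xc i))[v [vc c2 xv]].
exists (cell_upd c i [set v]%SET).
  apply: (crit_face cc).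
  - by apply: cub_upd; [exact: crit_cub | exact: tree_cell1].
  - apply/face_leP => l; rewrite ffunE; case: eqP => [->|] //.
    by rewrite finset.sub1set.
  - apply/eqP => /ffunP/(_ i); rewrite ffunE eqxx => h.
    by move: c2; rewrite -h finset.cards1.
by move=> l; rewrite ffunE; case: eqP => [->|].
Qed.

(** An interior point of [c] lies only in cells above [c]. Such a cell would force [c] into [A], by
    closedness if it lies in [A] and by [crit_face] if it is critical. *)
Lemma cell_rho_other c c' x : c \in crit -> c' \in K -> c' != c ->
  cell_set c x -> cell_set c' x -> cell_rho c x = 1.
Proof.
move=> cc c'K nc xc xc'; apply/eqP; rewrite eq_le cell_rho_le1 //= leNgt; apply/negP => rlt.
have lc : le c c'.
  apply/face_leP => i; apply: (cell_dist_lt1 treeE (crit_cell i cc) (xc i) (xc' i)).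
  exact: le_lt_trans (le_cell_rho c x i) rlt.
have cA : c \notin A by move: cc; rewrite inE => /andP[].
have [c'A|c'A] := boolP (c' \in A).
  by move/negP: cA; apply; apply: dA.2 (crit_cub cc) c'A lc.
have c'c : c' \in crit by rewrite inE c'A.
by move/negP: cA; apply; apply: (crit_face c'c (crit_cub cc) lc); rewrite eq_sym.
Qed.

Lemma cell_rho_A c x : c \in crit -> cell_set c x -> XA x -> cell_rho c x = 1.
Proof.
move=> cc xc [c' c'A xc']; apply: (@cell_rho_other c c') => //.
  exact: (fintype.subsetP AK).
by apply: contraTneq cc => <-; rewrite inE c'A.
Qed.

Lemma realization_split : X = XA `|` [set x | exists2 c, c \in enum crit & cell_set c x].
Proof.
apply/seteqP; split=> x.
  move=> [c cK xc]; have [cA|cA] := boolP (c \in A); first by left; exists c.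
  by right; exists c => //; rewrite mem_enum inE cA.
move=> [|[c]]; first exact: realization_sub.
by rewrite mem_enum inE => /andP[_ cK] xc; exists c.
Qed.

Lemma cell_rho_ctn c : continuous (cell_rho c).
Proof. by apply: cts_bigmax => i; exact: cell_dist_ctn. Qed.

(** * Extending the contraction over the critical cubes *)

Section HomotopyExtension.
Variables (H : E * R -> E) (p : E).
Hypothesis cH : contraction XA H p.

(** The divisor caps the expansion: [cell_rho] is multiplied by [1 + t] but never passes 1. *)
Definition stretch_factor c (z : E * R) : R := (1 + z.2) / Num.max 1 ((1 + z.2) * cell_rho c z.1).

(* Expands the cube by the factor [1 + t]; what leaves the cube is pushed back
   to its boundary and the overshoot becomes the time parameter of [H]. *)
Definition stretch c (z : E * R) : E * R :=
  ((fun i => cell_scale (c i) (stretch_factor c z) (z.1 i)) : E,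
   Num.max 0 ((1 + z.2) * cell_rho c z.1 - 1)).

Lemma stretch_continuous c : continuous (stretch c).
Proof.
have cr : continuous (fun z : E * R => (1 + z.2) * cell_rho c z.1).
  apply: cts_mul; first by apply: cts_add; [exact: cts_cst | exact: snd_continuous].
  by apply: (@comp_continuous _ E R fst); [exact: fst_continuous | exact: cell_rho_ctn].
apply: pair_continuous; last first.
  apply: cts_max; first exact: cts_cst.
  by apply: cts_sub => //; exact: cts_cst.
apply: prod_topology_continuous => i; apply: prod_topology_continuous => v.
apply: cts_add; first exact: cts_cst.
apply: cts_mul.
  apply: cts_sub; last exact: cts_cst.
  by apply: (@comp_continuous _ E R fst (fun x => x i v));
    [exact: fst_continuous | exact: coord_ctn].
apply: cts_div.
- by move=> z; rewrite gt_eqF // lt_max ltr01.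
- by apply: cts_add; [exact: cts_cst | exact: snd_continuous].
- by apply: cts_max => //; exact: cts_cst.
Qed.

Lemma stretchP c x t : c \in crit -> cell_set c x -> 0 <= t <= 1 ->
  cell_set c (stretch c (x, t)).1 /\
  ((stretch c (x, t)).2 = 0 \/ XA (stretch c (x, t)).1 /\ 0 <= (stretch c (x, t)).2 <= 1).
Proof.
move=> cc xc /andP[t0 t1]; rewrite /stretch /=.
have r0 := cell_rho_ge0 c x; have r1 := cell_rho_le1 cc xc.
set l := stretch_factor _ _.
have M0 : 0 < Num.max 1 ((1 + t) * cell_rho c x) by rewrite lt_max ltr01.
have l0 : 0 <= l by rewrite divr_ge0 ?ltW //=; lra.
have lr : cell_rho c x * l <= 1.
  by rewrite /l /stretch_factor /= mulrA ler_pdivrMr // mul1r mulrC le_max lexx orbT.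
have cs : cell_set c (fun i => cell_scale (c i) l (x i)).
  move=> i; apply: (closed_cell_scale treeE) => //; first exact: crit_cell.
  rewrite ger0_norm //; apply: le_trans lr; rewrite ler_wpM2r //; exact: le_cell_rho.
split=> //; have [h|h] := leP ((1 + t) * cell_rho c x - 1) 0; [by left|right].
split; last by nra.
apply: (cell_rho_eq1 cc cs); apply/eqP; rewrite eq_le cell_rho_le1 //=.
have rgt : 0 < cell_rho c x.
  by rewrite lt_neqAle r0 andbT; apply/eqP => r00; move: h; rewrite -r00; lra.
have [i iE] := cell_rho_attained rgt.
apply: le_trans (le_cell_rho _ _ i).
rewrite cell_dist_scale iE ger0_norm // /l /stretch_factor /= max_r; last by lra.
by rewrite mulrA [cell_rho c x * _]mulrC divff // mulf_neq0 // gt_eqF //; lra.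
Qed.

(** On the boundary the cap cancels the expansion and the overshoot is exactly [t]; hence the
    extension agrees there with [H]. *)
Lemma stretch_A c x t : c \in crit -> cell_set c x -> XA x -> 0 <= t <= 1 ->
  stretch c (x, t) = (x, t).
Proof.
move=> cc xc xA /andP[t0 t1]; have r1 := cell_rho_A cc xc xA.
rewrite /stretch /stretch_factor /= r1 mulr1 (_ : 1 + t - 1 = t); last by lra.
rewrite !max_r //; last by lra.
rewrite divff; last by rewrite gt_eqF //; lra.
by congr pair; apply: funext => i; rewrite cell_scale1.
Qed.

(** The choice of the critical cube is harmless, since two of them meet only in the realization of
    [A]. *)
Definition extension (z : E * R) : E :=
  if pselect (XA z.1) then H z
  else if [pick c in crit | `[< cell_set c z.1 >]] is Some c then extend_at0 H (stretch c z)
  else z.1.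

Lemma extension_A z : XA z.1 -> extension z = H z.
Proof. by rewrite /extension; case: pselect. Qed.

Lemma extension_crit c x t : c \in crit -> cell_set c x -> 0 <= t <= 1 ->
  extension (x, t) = extend_at0 H (stretch c (x, t)).
Proof.
move=> cc xc tI; rewrite /extension; case: pselect => [xA|xA] /=.
  rewrite stretch_A // /extend_at0 /=; case: eqP => // ->.
  by case: cH => _ _ _ + _; exact.
case: pickP => [c' /andP[c'c /asboolP xc']|/(_ c)]; last by rewrite cc /= => /asboolP.
have [->//|nc] := eqVneq c' c; exfalso; apply: xA.
apply: (cell_rho_eq1 cc xc); apply: (cell_rho_other cc _ nc xc xc').
by move: c'c; rewrite inE => /andP[].
Qed.

Lemma extension_continuous : {within X `*` `[(0:R), 1], continuous extension}.
Proof.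
have cXA : closed XA by exact: realization_closed.
rewrite (_ : X `*` _ = (XA `*` `[(0:R), 1]) `|`
   [set z | exists2 c, c \in enum crit & (cell_set c `*` `[(0:R), 1]) z]); last first.
  rewrite realization_split; apply/seteqP; split=> z.
    by move=> [[zA|[c cc zc]] zI]; [left | right; exists c].
  by move=> [[zA zI]|[c cc [zc zI]]]; split=> //; [left | right; exists c].
have cI : closed `[(0:R), 1] by exact: itv_closed.
apply: withinU_continuous.
- exact: closed_setX.
- by apply: closed_finite_cover => c _; apply: closed_setX => //; exact: cell_set_closed.
- by case: cH => _ + _ _ _; apply: within_eq => z [zA _]; rewrite extension_A.
- apply: within_finite_cover => c; rewrite mem_enum => cc.
    by apply: closed_setX => //; exact: cell_set_closed.
  apply: (@within_eq _ _ _ (fun z => extend_at0 H (stretch c z))).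
    by move=> [x t] [/= xc]; rewrite in_itv /= => tI; rewrite (extension_crit cc).
  apply: (within_comp (extend_at0_continuous cXA cH)).
    exact/continuous_subspaceT/stretch_continuous.
  move=> [x t] [/= xc]; rewrite in_itv /= => tI.
  have [_ [h|[h1 h2]]] := stretchP cc xc tI; first by right.
  by left; split=> //=; rewrite in_itv.
Qed.

Lemma extension_in x t : X x -> 0 <= t <= 1 -> X (extension (x, t)).
Proof.
move=> + tI; rewrite realization_split => -[xA|[c]].
  by left; rewrite extension_A //; case: cH => _ _ + _ _; exact.
rewrite mem_enum => cc xc; rewrite (extension_crit cc) // /extend_at0.
have [h1 h2] := stretchP cc xc tI; case: eqP => [_|ne].
  by right; exists c; rewrite ?mem_enum.
case: h2 => // -[hA hI]; left; rewrite [stretch _ _]surjective_pairing.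
by case: cH => _ _ + _ _; exact.
Qed.

Lemma extension0 x : X x -> extension (x, 0) = x.
Proof.
have I0 : 0 <= (0 : R) <= 1 by rewrite lexx ler01.
rewrite realization_split => -[xA|[c]].
  by rewrite extension_A //; case: cH => _ _ _ + _; exact.
rewrite mem_enum => cc xc; rewrite (extension_crit cc) // /extend_at0 /stretch /stretch_factor /=.
have := cell_rho_le1 cc xc; rewrite addr0 mul1r => r1.
rewrite max_l; last by lra.
by rewrite eqxx max_l // divr1; apply: funext => i; rewrite cell_scale1.
Qed.

End HomotopyExtension.

(** * Coordinates on a critical cube *)

Lemma edge_other (B : {set V}) v : tree_cell e B -> #|B| = 2%N -> v \in B ->
  exists w, v != w /\ B = [set v; w]%SET.
Proof.
move=> /tree_cellP[[a ->]|[a [b [eab ->]]]]; first by rewrite finset.cards1.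
have ab := tree_edge_neq treeE eab => _; rewrite !inE => /orP[]/eqP->; first by exists b.
by exists a; rewrite eq_sym finset.setUC.
Qed.

Lemma cell_dist_end (B : {set V}) v (y : V -> R) : tree_cell e B -> #|B| = 2%N -> v \in B ->
  closed_cell R B y -> cell_dist B y = `|2 * y v - 1|.
Proof.
move=> cB B2 vB /(closed_cellP treeE _ cB)[yB _].
by have [w [vw E]] := edge_other cB B2 vB; rewrite E in yB *; exact: cell_dist_edge.
Qed.

Lemma enum_crit j : enum_val j \in crit.
Proof. exact: enum_valP. Qed.

Definition edge_index j (l : 'I_d) : 'I_n :=
  enum_val (cast_ord (esym (crit_dim (enum_crit j))) l).

(** An affine identification of the edge with the interval from -1 to 1; [pick] decides which end
    gets the value 1. The default 0 never occurs, as cells are nonempty. *)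
Definition cube_coord j (l : 'I_d) x : R :=
  if [pick v in enum_val j (edge_index j l)] is Some v then 2 * x (edge_index j l) v - 1 else 0.

Lemma edge_index_card j l : #|enum_val j (edge_index j l)| = 2%N.
Proof. by have := enum_valP (cast_ord (esym (crit_dim (enum_crit j))) l); rewrite inE => /eqP. Qed.

Lemma edge_indexP j i : #|enum_val j i| = 2%N -> exists l, edge_index j l = i.
Proof.
move=> h; have hi : i \in [set i | #|enum_val j i| == 2%N]%SET by rewrite inE h.
exists (cast_ord (crit_dim (enum_crit j)) (enum_rank_in hi i)).
by rewrite /edge_index cast_ordK enum_rankK_in.
Qed.

Lemma cube_coord_dist j l x : cell_set (enum_val j) x ->
  `|cube_coord j l x| = cell_dist (enum_val j (edge_index j l)) (x (edge_index j l)).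
Proof.
move=> xc; have ct := crit_cell (edge_index j l) (enum_crit j).
rewrite /cube_coord; case: pickP => [v vc|none].
  by rewrite (cell_dist_end ct (edge_index_card j l) vc (xc _)).
by have [v] := tree_cell_neq0 ct; rewrite none.
Qed.

(** Vertex entries contribute 0 to [cell_rho], and edge entries the absolute values of the
    coordinates. *)
Lemma cell_rho_sup j x : cell_set (enum_val j) x ->
  cell_rho (enum_val j) x = sup_abs (fun l => cube_coord j l x).
Proof.
move=> xc; apply/eqP; rewrite eq_le; apply/andP; split.
  apply: bigmax_le; first exact: sup_abs_ge0.
  move=> i _; have ct := crit_cell i (enum_crit j).
  have [c1|/edge_indexP[l <-]] := tree_cell_card treeE ct; last first.
    by rewrite -cube_coord_dist //; exact: (le_sup_abs (fun l => cube_coord j l x)).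
  move: (xc i); move/eqP/cards1P: c1 => [v ->] /(closed_cellP treeE _ (tree_cell1 e v))[h _].
  by rewrite cell_dist_vertex //; exact: sup_abs_ge0.
apply: sup_abs_le; first exact: cell_rho_ge0.
by move=> l; rewrite cube_coord_dist //; exact: le_cell_rho.
Qed.

Definition cell_sphere j x : @euclidean_sphere R d :=
  SigSub (mem_set (cube_sphere_in (fun l => cube_coord j l x))).

Lemma cell_sphere_continuous j : continuous (cell_sphere j).
Proof.
apply: set_type_continuous; apply: cube_sphere_continuous => l.
rewrite /cube_coord; case: pickP => [v _|_]; last exact: cts_cst.
apply: cts_sub; last exact: cts_cst.
by apply: cts_mul; [exact: cts_cst | exact: coord_ctn].
Qed.

Lemma cell_sphere_base j x : cell_set (enum_val j) x ->
  cell_sphere j x = sphere_pt R d <-> XA x.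
Proof.
move=> xc; have rE := cell_rho_sup xc.
have -> : cell_sphere j x = sphere_pt R d <-> cube_height (fun l => cube_coord j l x) = 0.
  split=> [/(congr1 val)/= /eqP|h]; first by rewrite cube_sphere_base => /eqP.
  by apply: val_inj => /=; apply/eqP; rewrite cube_sphere_base h.
rewrite /cube_height -rE; split=> [h|xA].
  by apply: (cell_rho_eq1 (enum_crit j) xc); lra.
by rewrite (cell_rho_A (enum_crit j) xc xA) subrr.
Qed.

Lemma cell_sphere_inj j x x' : cell_set (enum_val j) x -> cell_set (enum_val j) x' ->
  cell_sphere j x = cell_sphere j x' -> ~ XA x -> x = x'.
Proof.
move=> xc xc' E nxA.
have r1 := cell_rho_le1 (enum_crit j) xc; have r1' := cell_rho_le1 (enum_crit j) xc'.
have rlt : cell_rho (enum_val j) x < 1.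
  rewrite lt_neqAle r1 andbT; apply/eqP => h; apply: nxA; exact: (cell_rho_eq1 (enum_crit j) xc h).
have uE : (fun l => cube_coord j l x) =1 (fun l => cube_coord j l x').
  apply: cube_sphere_inj; last by move: E => /(congr1 val).
    by rewrite /cube_height -cell_rho_sup //; lra.
  by rewrite /cube_height -cell_rho_sup //; lra.
apply: funext => i; apply: funext => v.
have ct := crit_cell i (enum_crit j).
have [h1 _] := (closed_cellP treeE _ ct).1 (xc i).
have [h1' _] := (closed_cellP treeE _ ct).1 (xc' i).
have [c1|c2] := tree_cell_card treeE ct.
  move/eqP/cards1P: c1 => [w cw]; rewrite cw in h1 h1'.
  by rewrite ((affine_vertexP _ _).1 h1) ((affine_vertexP _ _).1 h1').
have [l il] := edge_indexP c2; have := uE l; rewrite /cube_coord il.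
case: pickP => [w wc|none] hw; last by have [w] := tree_cell_neq0 ct; rewrite none.
have xw : x i w = x' i w by lra.
have [w' [ww' cE]] := edge_other ct c2 wc.
rewrite cE in h1 h1'.
have [z1 s1] := (affine_edgeP _ ww').1 h1; have [z1' s1'] := (affine_edgeP _ ww').1 h1'.
have [->//|vw] := eqVneq v w.
by have [->|vw'] := eqVneq v w'; [lra | rewrite z1 // z1'].
Qed.

Lemma cube_coord_surj j (u : 'I_d -> R) : (forall l, `|u l| <= 1) ->
  exists2 x, cell_set (enum_val j) x & forall l, cube_coord j l x = u l.
Proof.
move=> u1.
(* The default 1 at a vertex entry makes [(1 + ui i) / 2] the full weight 1 of that vertex. *)
pose ui i : R := if [pick l | edge_index j l == i] is Some l then u l else 1.
have ei_inj : injective (edge_index j) by move=> l l' /enum_val_inj/cast_ord_inj.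
have uil l : ui (edge_index j l) = u l.
  by rewrite /ui; case: pickP => [l' /eqP/ei_inj->//|/(_ l)]; rewrite eqxx.
pose x : E := fun i v => if v \in enum_val j i then
  (if [pick w in enum_val j i] == Some v then (1 + ui i) / 2 else (1 - ui i) / 2) else 0.
have pk i : exists2 w, [pick w in enum_val j i] = Some w & w \in enum_val j i.
  case: pickP => [w wc|none]; first by exists w.
  by have [w] := tree_cell_neq0 (crit_cell i (enum_crit j)); rewrite none.
have xl l : cube_coord j l x = u l.
  have [w pw wc] := pk (edge_index j l).
  by rewrite /cube_coord pw /x pw wc eqxx uil; lra.
exists x => // i; have [w pw wc] := pk i; have ct := crit_cell i (enum_crit j).
have [c1|c2] := tree_cell_card treeE ct.
  have uii : ui i = 1.
    rewrite /ui; case: pickP => // l /eqP il.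
    by have := edge_index_card j l; rewrite il c1.
  have cE : enum_val j i = [set w]%SET.
    by move/eqP/cards1P: c1 wc => [w' ->]; rewrite inE => /eqP ->.
  rewrite cE; apply/(closed_cell_vertexP treeE) => v; rewrite /x pw cE inE uii.
  by have [->|] := eqVneq v w; rewrite //= eqxx; lra.
have [l il] := edge_indexP c2.
have /ler_normlP[ul1 ul2] : `|ui i| <= 1 by rewrite -il uil.
have [w' [ww' cE]] := edge_other ct c2 wc.
split.
- by move=> v; rewrite /x; case: ifP => // _; case: ifP => _; lra.
- by move=> v vc; rewrite /x (negPf vc).
- rewrite (sum_edge ww'); last by move=> v vw vw'; rewrite /x cE !inE (negPf vw) (negPf vw').
  rewrite /x pw cE !inE !eqxx orbT /= (_ : (Some w == Some w') = false); first by lra.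
  by apply/negbTE.
Qed.

(** * The map onto the wedge *)

Section Wedge.
Variable j0 : 'I_#|crit|.
Local Notation W := (wedge_of_spheres R #|crit| d).

Definition lift_sphere j (q : @euclidean_sphere R d) : W :=
  @wedge_lift 'I_#|crit| (fun=> (@euclidean_sphere R d : topologicalType))
    (fun=> sphere_pt R d) j q.

(** The index [j0] only names the base point, which is common to all spheres. The last branch is
    reached only outside the complex. *)
Definition wedge_map x : W :=
  if pselect (XA x) then lift_sphere j0 (sphere_pt R d)
  else if [pick j | `[< cell_set (enum_val j) x >]] is Some j then lift_sphere j (cell_sphere j x)
  else lift_sphere j0 (sphere_pt R d).

Lemma lift_sphere_pt j j' : lift_sphere j (sphere_pt R d) = lift_sphere j' (sphere_pt R d).
Proof. exact: (@wedge_liftE _ _ _ j' (sphere_pt R d) j (sphere_pt R d)). Qed.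

Lemma wedge_map_A x : XA x -> wedge_map x = lift_sphere j0 (sphere_pt R d).
Proof. by rewrite /wedge_map; case: pselect. Qed.

Lemma wedge_map_crit j x : cell_set (enum_val j) x -> wedge_map x = lift_sphere j (cell_sphere j x).
Proof.
move=> xc; rewrite /wedge_map; case: pselect => [xA|nxA] /=.
  by rewrite (cell_sphere_base xc).2 //; exact: lift_sphere_pt.
case: pickP => [j' /asboolP xc'|/(_ j)/asboolP//].
have [->//|nj] := eqVneq j' j; exfalso; apply: nxA.
apply: (cell_rho_eq1 (enum_crit j) xc).
apply: (cell_rho_other (enum_crit j) _ _ xc xc'); last by rewrite (inj_eq enum_val_inj).
by have := enum_crit j'; rewrite inE => /andP[].
Qed.

Lemma wedge_map_continuous : {within X, continuous wedge_map}.
Proof.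
rewrite realization_split; apply: withinU_continuous.
- exact: realization_closed.
- by apply: closed_finite_cover => c _; exact: cell_set_closed.
- apply: (@within_eq _ _ _ (fun=> lift_sphere j0 (sphere_pt R d))).
    by move=> x /wedge_map_A.
  by apply: continuous_subspaceT; exact: cst_continuous.
- apply: within_finite_cover => c; rewrite mem_enum => cc; first exact: cell_set_closed.
  pose j := enum_rank_in cc c; have jE : enum_val j = c by rewrite enum_rankK_in.
  rewrite -jE; apply: (@within_eq _ _ _ (fun x => lift_sphere j (cell_sphere j x))).
    by move=> x /wedge_map_crit.
  apply: continuous_subspaceT; apply: (@comp_continuous _ _ _ (cell_sphere j) (lift_sphere j)).
    exact: cell_sphere_continuous.
  exact (@wedge_lift_continuous 'I_#|crit| (fun=> (@euclidean_sphere R d : topologicalType))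
    (fun=> sphere_pt R d) j).
Qed.

(** The base point is hit by [A], which must therefore be nonempty: for [d = 0] a critical cube is a
    single point and goes to the other point of its sphere. *)
Lemma wedge_map_surj w : XA !=set0 -> exists2 x, X x & wedge_map x = w.
Proof.
move=> [a aA].
have : [set: W] w by []; rewrite -(@wedgeTE 'I_#|crit|) => -[j _ [q _ <-]].
have [qb|nqb] := pselect (q = sphere_pt R d).
  exists a; first exact: realization_sub aA.
  by rewrite wedge_map_A // qb; exact: lift_sphere_pt.
have qs : euclidean_sphere (val q) by exact: set_valP.
have [|u [u1 uq]] := cube_sphere_surj qs.
  apply/eqP => q1; apply: nqb; apply: val_inj; exact: (sphere_baseP qs q1).
have [x xc xu] := @cube_coord_surj j u u1.
exists x; first by exists (enum_val j) => //; have := enum_crit j; rewrite inE => /andP[].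
rewrite (wedge_map_crit xc); congr (lift_sphere j _); apply: val_inj => /=.
by rewrite -uq; congr cube_sphere; apply: funext.
Qed.

Lemma wedge_map_inj x x' : X x -> X x' -> wedge_map x = wedge_map x' -> x = x' \/ XA x /\ XA x'.
Proof.
have caseX y : X y -> XA y \/ ~ XA y /\ exists j, cell_set (enum_val j) y.
  move=> Xy; have [yA|nyA] := pselect (XA y); [by left|right; split=> //].
  move: Xy; rewrite realization_split => -[//|[c]]; rewrite mem_enum => cc yc.
  by exists (enum_rank_in cc c); rewrite enum_rankK_in.
move=> /caseX[xA|[nxA [j xc]]] /caseX[xA'|[nxA' [j' xc']]].
- by right.
- rewrite wedge_map_A // (wedge_map_crit xc') => /esym/wedge_lift_eq[[_ h]|[h _]];
    by case: nxA'; apply/(cell_sphere_base xc').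
- rewrite (wedge_map_A xA') (wedge_map_crit xc) => /wedge_lift_eq[[_ h]|[h _]];
    by case: nxA; apply/(cell_sphere_base xc).
- rewrite (wedge_map_crit xc) (wedge_map_crit xc') => /wedge_lift_eq[[jj h]|[h _]].
    left; rewrite -jj in xc' h; exact: cell_sphere_inj h nxA.
  by case: nxA; apply/(cell_sphere_base xc).
Qed.

End Wedge.

Lemma realization_wedge : (0 < #|crit|)%N ->
  (exists (H : E * R -> E) p, contraction XA H p) ->
  homotopy_equivalent R X (wedge_of_spheres R #|crit| d).
Proof.
move=> k0 [H [p cH]]; pose j0 := Ordinal k0.
have valI (t : @unit_interval R) : 0 <= 1 - set_val t <= 1.
  have h (r : R) : @unit_interval R r -> 0 <= 1 - r <= 1.
    by rewrite /unit_interval /= in_itv /= => /andP[r0 r1]; lra.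
  exact/h/set_valP.
(* Time is reversed because [collapse_equivalence] wants the identity at time 1. *)
have Gin (z : X * @unit_interval R) : X (extension H (set_val z.1, 1 - set_val z.2)).
  by apply: (extension_in cH) => //; exact: set_valP.
pose G (z : X * @unit_interval R) : X := SigSub (mem_set (Gin z)).
apply: (@collapse_equivalence R X _ [set x : X | XA (set_val x)]
  (fun x : X => wedge_map j0 (set_val x)) G).
- by apply: set_type_compact; exact: realization_compact.
- apply: wedge_hausdorff => j; apply: set_type_hausdorff; exact: norm_hausdorff.
- by have /subspace_sigL_continuousP := @wedge_map_continuous j0.
- move=> w; have [|x Xx xw] := @wedge_map_surj j0 w; first by exists p; case: cH.
  by exists (SigSub (mem_set Xx)).
- move=> x x' /wedge_map_inj[||h|]; [exact: set_valP|exact: set_valP| |by right].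
  by left; exact: val_inj.
- by move=> x x' /= xA xA'; rewrite !wedge_map_A.
- apply: set_type_continuous; apply/continuous_subspace_setT.
  apply: (within_comp (extension_continuous cH)).
    apply: continuous_subspaceT; apply: pair_continuous.
      apply: (@comp_continuous _ X E fst set_val); first exact: fst_continuous.
      exact: set_val_continuous.
    apply: cts_sub; first exact: cts_cst.
    apply: (@comp_continuous _ (@unit_interval R) R snd set_val); first exact: snd_continuous.
    exact: set_val_continuous.
  by move=> z _; split=> /=; [exact: set_valP | rewrite in_itv /=].
- move=> x t xA; change (XA (extension H (set_val x, 1 - set_val t))).
  by rewrite extension_A //; case: cH => _ _ + _ _; exact.
- move=> x x' t t0 xA xA'; apply: val_inj.
  change (extension H (set_val x, 1 - set_val t) = extension H (set_val x', 1 - set_val t)).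
  by rewrite t0 subr0 !extension_A //; case: cH => _ _ _ _ h1; rewrite !h1.
- move=> x t t1; apply: val_inj.
  change (extension H (set_val x, 1 - set_val t) = set_val x).
  by rewrite t1 subrr (extension0 cH) //; exact: set_valP.
Qed.

End Assembly.

Lemma stirling_vertex_cover (V : finType) (e : rel V) n :
  stirling_complex e n = vertex_cover e n [set: V]%SET.
Proof.
apply/finset.setP => c; rewrite !inE; congr (_ && _).
by apply: eq_forallb => v; rewrite inE.
Qed.

Local Open Scope ring_scope.

Theorem theorem2p1 (R : realType) (m n : nat) (V : finType) (e : rel V) :
  (2 <= m)%N -> (m <= n)%N -> #|V| = m -> tree e ->
  exists2 k : nat, k%:Z = stirling_f m n &
    homotopy_equivalent R (stirling_space e R n) (wedge_of_spheres R k (n - m)).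
Proof.
move=> m2 mn Vm treeE.
have V0 : (0 < #|V|)%N by rewrite Vm; lia.
have Tm : #|[set: V]%SET| = m by rewrite finset.cardsT.
have Tn : (#|[set: V]%SET| <= n)%N by rewrite Tm.
have n0 : (0 < n)%N by lia.
have [A [p cA]] := critical_complex treeE V0 Tn.
have kE := critical_count treeE V0 cA Tn n0; rewrite Tm in kE.
have [sA dA mp colA top] := cA.
exists #|(vertex_cover e n [set: V] :\: A)%SET|; first exact: kE.
rewrite /stirling_space stirling_vertex_cover.
apply: (realization_wedge treeE) => //.
- exact: vertex_cover_closed.
- move=> c; rewrite inE => /andP[cnA cX]; have := top _ cX cnA; rewrite Tm; lia.
(* The index set of the wedge is nonempty because [2 <= m <= n]. *)
- rewrite -ltz_nat kE -sphere_countE //; apply: sphere_count_gt0 => //; lia.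
- exact: (collapse_contraction R treeE dA mp colA).
Qed.
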